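(* Let $m\in\mathbb Z$. For all $N\ge1$, $$\int_{L_1\cup L_2\cup L_3\cup L_5\cup L_6\cup L_7}\frac{e^{z/N}}{2\pi i\,(e^{z/N}-1)^{m+1}(e^{z/N})_N}\,dz=O\big(N^{m+1}e^{0.05N}\big),$$ with implied constant depending only on $m$.
   Context: $(q)_N:=(1-q)(1-q^2)\cdots(1-q^N)$. $z_0\approx-1.6055276+7.4234262i$ is $2\pi i+\log(1-w_0)$ where $w_0\approx0.91619782-0.18245890i$ solves $\mathrm{Li}_2(w)=2\pi i\log w$. Let $c:=\mathrm{Re}(z_0)/\mathrm{Im}(z_0)+i$. The oriented line segments are: $L_1$ from $2\pi$ to $2\pi+8\pi i/5$; $L_2$ from $2\pi+8\pi i/5$ to $-\pi/10+8\pi i/5$; $L_3$ from $-\pi/10+8\pi i/5$ to $2\pi c$; ($L_4$ from $2\pi c$ to $3\pi c$, excluded); $L_5$ from $3\pi c$ to $6\pi c$; $L_6$ from $6\pi c$ to $-20\pi+6\pi i$; $L_7$ from $-20\pi+6\pi i$ to $-20\pi$. *)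

(* Defs.v *)
From Stdlib Require Import Reals Lra ZArith.
Open Scope R_scope.

Record Cx := mkC { Re : R; Im : R }.

Definition C0 : Cx := mkC 0 0.
Definition C1 : Cx := mkC 1 0.
Definition Ci : Cx := mkC 0 1.
Definition RtoC (x : R) : Cx := mkC x 0.
Definition Cadd (z w : Cx) : Cx := mkC (Re z + Re w) (Im z + Im w).
Definition Copp (z : Cx) : Cx := mkC (- Re z) (- Im z).
Definition Csub (z w : Cx) : Cx := Cadd z (Copp w).
Definition Cmul (z w : Cx) : Cx :=
  mkC (Re z * Re w - Im z * Im w) (Re z * Im w + Im z * Re w).
Definition Cnorm2 (z : Cx) : R := Re z * Re z + Im z * Im z.
Definition Cnorm (z : Cx) : R := sqrt (Cnorm2 z).
Definition Cinv (z : Cx) : Cx := mkC (Re z / Cnorm2 z) (- Im z / Cnorm2 z).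
Definition Cdiv (z w : Cx) : Cx := Cmul z (Cinv w).
Definition Cexp (z : Cx) : Cx := mkC (exp (Re z) * cos (Im z)) (exp (Re z) * sin (Im z)).

Fixpoint Cpow (z : Cx) (n : nat) : Cx :=
  match n with O => C1 | S k => Cmul z (Cpow z k) end.
Definition Czpow (z : Cx) (k : Z) : Cx :=
  match k with
  | Z0 => C1
  | Zpos p => Cpow z (Pos.to_nat p)
  | Zneg p => Cinv (Cpow z (Pos.to_nat p))
  end.

(* principal argument in (-pi, pi] and principal logarithm *)
Definition Carg (z : Cx) : R :=
  let x := Re z in let y := Im z in
  if Rlt_dec 0 x then atan (y / x)
  else if Rlt_dec x 0 then
    (if Rle_dec 0 y then atan (y / x) + PI else atan (y / x) - PI)
  else (if Rlt_dec 0 y then PI / 2 else if Rlt_dec y 0 then - (PI / 2) else 0).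
Definition Clog (z : Cx) : Cx := mkC (ln (Cnorm z)) (Carg z).

Fixpoint qpoch (q : Cx) (N : nat) : Cx :=
  match N with
  | O => C1
  | S n => Cmul (qpoch q n) (Csub C1 (Cpow q (S n)))
  end.

(* dilogarithm via its power series sum_{k>=1} w^k / k^2 (valid for |w| <= 1) *)
Fixpoint Li2_partial (w : Cx) (n : nat) : Cx :=
  match n with
  | O => C0
  | S k => Cadd (Li2_partial w k)
                (Cmul (Cpow w (S k)) (RtoC (/ (INR (S k) * INR (S k)))))
  end.
Definition Li2_is (w v : Cx) : Prop :=
  Un_cv (fun n => Re (Li2_partial w n)) (Re v) /\
  Un_cv (fun n => Im (Li2_partial w n)) (Im v).

Definition z0_of (w0 : Cx) : Cx := Cadd (Cmul (RtoC (2 * PI)) Ci) (Clog (Csub C1 w0)).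
Definition c_of (w0 : Cx) : Cx := mkC (Re (z0_of w0) / Im (z0_of w0)) 1.

Definition integrand (m : Z) (N : nat) (z : Cx) : Cx :=
  let q := Cexp (Cmul z (RtoC (/ INR N))) in
  Cdiv q (Cmul (Cmul (Cmul (RtoC (2 * PI)) Ci) (Czpow (Csub q C1) (m + 1)))
               (qpoch q N)).

Definition seg_integral (f : Cx -> Cx) (a b : Cx) (I : Cx) : Prop :=
  let g := fun t : R => Cmul (f (Cadd a (Cmul (RtoC t) (Csub b a)))) (Csub b a) in
  exists (pr1 : Riemann_integrable (fun t => Re (g t)) 0 1)
         (pr2 : Riemann_integrable (fun t => Im (g t)) 0 1),
    RiemannInt pr1 = Re I /\ RiemannInt pr2 = Im I.

Definition P1 : Cx := mkC (2 * PI) 0.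
Definition P2 : Cx := mkC (2 * PI) (8 * PI / 5).
Definition P3 : Cx := mkC (- (PI / 10)) (8 * PI / 5).
Definition P4 (w0 : Cx) : Cx := Cmul (RtoC (2 * PI)) (c_of w0).
Definition P5 (w0 : Cx) : Cx := Cmul (RtoC (3 * PI)) (c_of w0).
Definition P6 (w0 : Cx) : Cx := Cmul (RtoC (6 * PI)) (c_of w0).
Definition P7 : Cx := mkC (- (20 * PI)) (6 * PI).
Definition P8 : Cx := mkC (- (20 * PI)) 0.

Definition w0_approx : Cx := mkC (91619782 / 100000000) (- (18245890 / 100000000)).

(* Main.v *)
(** Write z = x + iy and q = e^(z/N).  The integrand is bounded pointwise, using
    log(1/|(q)_N|) = - sum_(j <= N) ln |1 - e^(jz/N)| and the location of z.

    On L1, |1 - q^j| >= 2 pi j/N and sum ln (j/N) >= -N suffice.  On the part of L2 with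
    x >= -1/5, |1 - q^j| >= 2 e^(jx/2N) sin (jy/2N) together with sin u >= u (1 - u/pi)
    leaves the exponent x/4 + ln (8 pi/5) - 2 + (ln 5)/4 >= -0.05.

    Everywhere else x <= -1/5.  There the logarithm is expanded into its power series,
    cut at a large K; each power e^(jkz/N) is summed over j by comparison with an
    integral, and the remainder is a small multiple of (1 - e^(jx/N))^(-1/2), whose sum
    over j is O(N).  The exponent is thus Re ((Li2 (e^z) - Li2 1)/z) up to an arbitrarily
    small error, and elementary estimates show that it is below 0.0495 on the contour.
    For w0 only the enclosure -0.219 <= Re c <= -0.212 matters. *)

From Stdlib Require Import Reals Lra Lia ZArith.
From Coquelicot Require Import Rcomplements Hierarchy Derive AutoDerive.
Require Import Defs.
Open Scope R_scope.

(** * The logarithm of |1 - r e^(i theta)| *)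

(** When j is small compared with N, the point e^(jz/N) is close to 1, where the logarithmic series
    converges arbitrarily slowly: no fixed [K] makes its remainder small for all j at once. The
    remainder is therefore made small only in mean over j, which the integrable singularity (1 -
    r)^(-1/2) permits. The constant in that mean grows like |x|^(-1/2) as x tends to 0, so this
    method must stay away from x = 0.

    The threshold -1/5 is where the sine estimate on L2 has spent the whole allowance 0.05 on |x|/4;
    to its left the bound 0.0495 leaves 0.0005 for the series error.

    The factor N^(m+1) reflects that |e^(z/N) - 1| has exact order 1/N on the contour. The sign of m
    + 1 is arbitrary, so this quantity is bounded both from below and from above.

    The omitted segment is the one through z0, which equals Im(z0) c with Im(z0) between 2 pi and 3
    pi. *)

Fixpoint sum1 (f : nat -> R) (n : nat) : R :=
  match n with O => 0 | S k => sum1 f k + f (S k) end.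

Lemma sum1_le (f g : nat -> R) (n : nat) :
  (forall k, (1 <= k <= n)%nat -> f k <= g k) -> sum1 f n <= sum1 g n.
Proof.
  induction n as [|n IH]; simpl; intros H; [lra|].
  apply Rplus_le_compat; [apply IH; intros; apply H; lia | apply H; lia].
Qed.

Lemma sum1_ext (f g : nat -> R) (n : nat) :
  (forall k, (1 <= k <= n)%nat -> f k = g k) -> sum1 f n = sum1 g n.
Proof.
  intros H; apply Rle_antisym; apply sum1_le; intros k Hk; rewrite H; auto; lra.
Qed.

Lemma sum1_plus (f g : nat -> R) (n : nat) :
  sum1 (fun k => f k + g k) n = sum1 f n + sum1 g n.
Proof. induction n as [|n IH]; simpl; [|rewrite IH]; ring. Qed.

Lemma sum1_scal (c : R) (f : nat -> R) (n : nat) :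
  sum1 (fun k => c * f k) n = c * sum1 f n.
Proof. induction n as [|n IH]; simpl; [|rewrite IH]; ring. Qed.

Lemma sum1_const (c : R) (n : nat) : sum1 (fun _ => c) n = INR n * c.
Proof. induction n as [|n IH]; [simpl; ring|]. rewrite S_INR; simpl; rewrite IH; ring. Qed.

Lemma sum1_swap (f : nat -> nat -> R) (m n : nat) :
  sum1 (fun j => sum1 (f j) m) n = sum1 (fun k => sum1 (fun j => f j k) n) m.
Proof.
  induction n as [|n IH]; simpl.
  - rewrite sum1_const; ring.
  - rewrite IH, sum1_plus; reflexivity.
Qed.

Lemma sum1_telescope_le (f G : nat -> R) (n : nat) :
  (forall k, (k < n)%nat -> f (S k) <= G (S k) - G k) -> sum1 f n <= G n - G O.
Proof.
  induction n as [|n IH]; simpl; intros H; [lra|].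
  assert (sum1 f n <= G n - G O) by (apply IH; intros; apply H; lia).
  specialize (H n ltac:(lia)); lra.
Qed.

Lemma deriv_nonneg_le (f df : R -> R) (a b : R) :
  a <= b -> (forall x, a <= x <= b -> is_derive f x (df x)) ->
  (forall x, a <= x <= b -> 0 <= df x) -> f a <= f b.
Proof.
  intros Hab Hd Hp.
  destruct (MVT_gen f a b df) as [c [Hc E]].
  - rewrite Rmin_left, Rmax_right by lra; intros x Hx; apply Hd; lra.
  - rewrite Rmin_left, Rmax_right by lra; intros x Hx.
    apply continuity_pt_filterlim.
    apply (ex_derive_continuous (V := R_NormedModule)); exists (df x); apply Hd; lra.
  - rewrite Rmin_left, Rmax_right in Hc by lra.
    specialize (Hp c Hc); nra.
Qed.

(** The squared modulus |1 - r e^(i th)|^2, written as a real polynomial in [r] so that it can be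
    differentiated in [r]. *)
Definition dist1 (r th : R) : R := 1 - 2 * r * cos th + r * r.

Lemma dist1_ge (r th : R) : 0 <= r -> (1 - r) * (1 - r) <= dist1 r th.
Proof. intros Hr; unfold dist1; pose proof (COS_bound th); nra. Qed.

(** With z = r e^(i th) the sum is the real part of e^(i th) (1 - z^K) / (1 - z); multiplying by |1
    - z|^2 clears the denominator. *)
Lemma sum_cos_geometric (r th : R) (K : nat) :
  dist1 r th * sum1 (fun k => r ^ (k - 1) * cos (INR k * th)) K =
  cos th - r - r ^ K * (cos (INR (S K) * th) - r * cos (INR K * th)).
Proof.
  induction K as [|K IH].
  - simpl sum1. simpl pow. replace (INR 1) with 1 by (simpl; ring).
    replace (INR 0 * th) with 0 by (simpl; ring). rewrite cos_0, (Rmult_1_l th); ring.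
  - change (sum1 (fun k => r ^ (k - 1) * cos (INR k * th)) (S K)) with
      (sum1 (fun k => r ^ (k - 1) * cos (INR k * th)) K
       + r ^ (S K - 1) * cos (INR (S K) * th)).
    rewrite Rmult_plus_distr_l, IH.
    replace (S K - 1)%nat with K by lia. simpl pow.
    replace (INR (S (S K)) * th) with (INR (S K) * th + th) by (rewrite (S_INR (S K)); ring).
    replace (INR K * th) with (INR (S K) * th - th) by (rewrite S_INR; ring).
    rewrite cos_plus, cos_minus; unfold dist1; ring.
Qed.

(** The bracket is the real part of e^(i K th) (e^(i th) - r), whose squared modulus is
    [dist1 r th]; the square of the imaginary part is dropped. *)
Lemma sum_cos_geometric_remainder (r th : R) (K : nat) :
  (cos (INR (S K) * th) - r * cos (INR K * th)) ^ 2 <= dist1 r th.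
Proof.
  replace (INR (S K) * th) with (INR K * th + th) by (rewrite S_INR; ring).
  rewrite cos_plus.
  set (c := cos (INR K * th)); set (s := sin (INR K * th)).
  assert (E : s * s + c * c = 1) by apply (sin2_cos2 (INR K * th)).
  assert (E' : sin th * sin th + cos th * cos th = 1) by apply (sin2_cos2 th).
  assert (D : dist1 r th = (cos th - r) ^ 2 + sin th * sin th) by (unfold dist1; nra).
  rewrite D.
  assert (0 <= (s * (cos th - r) + c * sin th) ^ 2) by apply pow2_ge_0.
  assert ((c * cos th - s * sin th - r * c) ^ 2 + (s * (cos th - r) + c * sin th) ^ 2
          = (s * s + c * c) * ((cos th - r) ^ 2 + sin th * sin th)) by ring.
  rewrite E in H0; lra.
Qed.

Lemma is_derive_sum_pow_cos (r th : R) (K : nat) :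
  is_derive (fun r => sum1 (fun k => r ^ k * cos (INR k * th) / INR k) K) r
            (sum1 (fun k => r ^ (k - 1) * cos (INR k * th)) K).
Proof.
  induction K as [|K IH]; cbn [sum1].
  - apply (is_derive_const (V := R_NormedModule)).
  - apply (is_derive_plus (V := R_NormedModule)); [exact IH|].
    assert (INR (S K) <> 0) by (apply not_0_INR; lia).
    auto_derive; [auto|].
    replace (S K - 1)%nat with K by lia.
    change (match K with 0%nat => 1 | S _ => INR K + 1 end) with (INR (S K)).
    simpl pred. field; auto.
Qed.

(** Each of the n summands of (1 - r)(1 + r + ... + r^(n-1)) = 1 - r^n is at least r^n (1 - r). The
    case n = 2K controls the square of r^K sqrt(1 - r). *)
Lemma pow_double_one_minus (r : R) (K : nat) :
  0 <= r <= 1 -> INR K * (r ^ (2 * K) * (1 - r)) <= 1.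
Proof.
  intros Hr.
  assert (G : INR (2 * K) * (r ^ (2 * K) * (1 - r)) <= 1 - r ^ (2 * K)).
  { generalize (2 * K)%nat as n; induction n as [|n IH]; [simpl; lra|].
    rewrite S_INR; simpl pow.
    assert (0 <= r ^ n) by (apply pow_le; lra).
    pose proof (pos_INR n).
    assert (r * (INR n * (r ^ n * (1 - r))) <= r * (1 - r ^ n))
      by (apply Rmult_le_compat_l; lra).
    assert (r ^ n <= 1) by (rewrite <- (pow1 n); apply pow_incr; lra).
    assert (0 <= (1 - r) * r ^ n * r) by (repeat apply Rmult_le_pos; lra).
    assert (0 <= (1 - r) * (1 - r * r ^ n)) by (apply Rmult_le_pos; nra).
    nra. }
  rewrite mult_INR in G; change (INR 2) with 2 in G.
  assert (0 <= r ^ (2 * K)) by (apply pow_le; lra).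
  pose proof (pos_INR K).
  assert (0 <= INR K * (r ^ (2 * K) * (1 - r))) by (repeat apply Rmult_le_pos; lra).
  lra.
Qed.

(** After clearing denominators the claim is r^K sqrt(1 - r) <= eps, and the square of the left side
    is at most 1/K, hence at most eps^2. *)
Lemma tail_derivative_bound (r eps : R) (K : nat) :
  0 <= r < 1 -> 0 < eps -> 1 <= INR K * (eps * eps) ->
  r ^ K / (1 - r) <= eps / ((1 - r) * sqrt (1 - r)).
Proof.
  intros Hr He HK.
  assert (Hs : 0 < sqrt (1 - r)) by (apply sqrt_lt_R0; lra).
  assert (Hss : sqrt (1 - r) * sqrt (1 - r) = 1 - r) by (apply sqrt_sqrt; lra).
  set (s := sqrt (1 - r)) in *.
  assert (H : r ^ K * s <= eps).
  { apply Rsqr_incr_0_var; [|lra]. unfold Rsqr.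
    pose proof (pow_double_one_minus r K ltac:(lra)) as P.
    replace (2 * K)%nat with (K + K)%nat in P by lia. rewrite pow_add in P.
    replace (r ^ K * s * (r ^ K * s)) with (r ^ K * r ^ K * (1 - r)) by (rewrite <- Hss; ring).
    assert (0 <= r ^ K * r ^ K * (1 - r)) by (pose proof (pow_le r K ltac:(lra)); nra).
    set (v := r ^ K * r ^ K * (1 - r)) in *.
    assert (INR K * v <= INR K * (eps * eps)) by lra.
    assert (0 < INR K) by (pose proof (pos_INR K); nra).
    apply Rmult_le_reg_l with (INR K); lra. }
  replace (r ^ K / (1 - r)) with (r ^ K * s / ((1 - r) * s)) by (field; split; lra).
  unfold Rdiv; apply Rmult_le_compat_r; [|lra].
  left; apply Rinv_0_lt_compat; nra.
Qed.

(* In the logarithmic series the remainder after [K] terms has [r]-derivative at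
   most [r^K / (1 - r)], which is dominated by that of an integrable singularity
   [(1 - r)^(-1/2)] with a small coefficient. *)
Lemma neg_ln_dist1_le (r th eps : R) (K : nat) :
  0 <= r < 1 -> 0 < eps -> 1 <= INR K * (eps * eps) ->
  - (ln (dist1 r th) / 2) <=
  sum1 (fun k => r ^ k * cos (INR k * th) / INR k) K + 2 * eps * (/ sqrt (1 - r) - 1).
Proof.
  intros Hr He HK.
  set (h := fun r => sum1 (fun k => r ^ k * cos (INR k * th) / INR k) K
     + (2 * eps * (/ sqrt (1 - r) - 1) + ln (dist1 r th) / 2)).
  assert (H0 : h 0 = 0).
  { unfold h. unfold dist1.
    replace (1 - 2 * 0 * cos th + 0 * 0) with 1 by ring.
    rewrite Rminus_0_r, sqrt_1, ln_1.
    replace (sum1 _ K) with 0; [field|].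
    symmetry; transitivity (sum1 (fun _ => 0) K); [|rewrite sum1_const; ring].
    apply sum1_ext; intros k Hk.
    assert (INR k <> 0) by (apply not_0_INR; lia).
    rewrite pow_i by lia; field; auto. }
  enough (h 0 <= h r) by (unfold h in *; lra).
  apply deriv_nonneg_le with
    (df := fun r => sum1 (fun k => r ^ (k - 1) * cos (INR k * th)) K
       + (eps / ((1 - r) * sqrt (1 - r)) + (r - cos th) / dist1 r th)); [lra| |].
  - intros x Hx. unfold h.
    apply (is_derive_plus (V := R_NormedModule)); [apply is_derive_sum_pow_cos|].
    assert (0 < 1 - x) by lra.
    assert (0 < sqrt (1 - x)) by (apply sqrt_lt_R0; lra).
    assert (sqrt (1 - x) * sqrt (1 - x) = 1 - x) by (apply sqrt_sqrt; lra).
    assert (0 < dist1 x th) by (pose proof (dist1_ge x th ltac:(lra)); nra).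
    unfold dist1 in *.
    auto_derive; change (1 + - x) with (1 - x); [repeat split; lra|].
    set (s := sqrt (1 - x)) in *.
    replace (1 + - (2 * x * cos th) + x * x) with (1 - 2 * x * cos th + x * x) by ring.
    replace (1 - x) with (s * s) by lra.
    field; repeat split; lra.
  - intros x Hx.
    pose proof (dist1_ge x th ltac:(lra)) as D.
    assert (Dp : 0 < dist1 x th) by nra.
    pose proof (sum_cos_geometric x th K) as G.
    pose proof (sum_cos_geometric_remainder x th K) as Q.
    pose proof (tail_derivative_bound x eps K ltac:(lra) He HK) as T.
    set (S := sum1 _ K) in *. set (q := cos (INR (Datatypes.S K) * th) - x * cos (INR K * th)) in *.
    (* The derivative of the logarithm cancels that of the partial sum, up to the remainder of the
       geometric sum. *)
    assert (E : S + (x - cos th) / dist1 x th = - (x ^ K * q / dist1 x th)).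
    { apply Rmult_eq_reg_l with (dist1 x th); [|lra].
      transitivity (dist1 x th * S + (x - cos th)); [field; lra|].
      rewrite G; field; lra. }
    (* Both |q| and [1 - x] are at most the square root of [dist1 x th], so their product is at most
       [dist1 x th]. *)
    assert (x ^ K * q / dist1 x th <= x ^ K / (1 - x)).
    { assert (0 <= x ^ K) by (apply pow_le; lra).
      assert (q / dist1 x th <= / (1 - x)).
      { apply Rmult_le_reg_r with (dist1 x th * (1 - x)); [apply Rmult_lt_0_compat; lra|].
        replace (q / dist1 x th * (dist1 x th * (1 - x))) with (q * (1 - x)) by (field; lra).
        replace (/ (1 - x) * (dist1 x th * (1 - x))) with (dist1 x th) by (field; lra).
        destruct (Rle_dec (q * (1 - x)) 0) as [Hq|Hq]; [lra|].
        assert (q ^ 2 * (1 - x) ^ 2 <= dist1 x th * dist1 x th) by (apply Rmult_le_compat; nra).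
        nra. }
      unfold Rdiv in *; rewrite Rmult_assoc; apply Rmult_le_compat_l; auto. }
    lra.
Qed.

(** * Riemann sums *)

Lemma exp_le_exp (x y : R) : x <= y -> exp x <= exp y.
Proof. intros [H| ->]; [left; apply exp_increasing; auto|lra]. Qed.

Lemma exp_INR_mult (k : nat) (x : R) : exp (INR k * x) = exp x ^ k.
Proof.
  induction k as [|k IH]; [simpl; rewrite Rmult_0_l; apply exp_0|].
  rewrite S_INR, Rmult_plus_distr_r, exp_plus, IH, Rmult_1_l; simpl; ring.
Qed.

Lemma increment_le (f df : R -> R) (L a b : R) :
  a <= b -> (forall x, a <= x <= b -> is_derive f x (df x)) ->
  (forall x, a <= x <= b -> df x <= L) -> f b - f a <= L * (b - a).
Proof.
  intros Hab Hd HL.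
  enough (L * a - f a <= L * b - f b) by lra.
  apply deriv_nonneg_le with (f := fun x => L * x - f x) (df := fun x => L - df x); auto.
  - intros x Hx.
    apply (is_derive_minus (V := R_NormedModule) (fun x => L * x) f); [|auto].
    auto_derive; auto; ring.
  - intros x Hx; specialize (HL x Hx); lra.
Qed.

(** On a cell of length 1/N the right endpoint value exceeds the mean of [f] by at most L/N; the N
    cells together lose [L]. Only the increase of [f] has to be controlled, since only an upper
    bound is wanted. *)
Lemma riemann_sum_le (f G : R -> R) (L : R) (N : nat) :
  (1 <= N)%nat -> 0 <= L ->
  (forall s, 0 <= s <= 1 -> is_derive G s (f s)) ->
  (forall s t, 0 <= s <= t -> t <= 1 -> f t - f s <= L * (t - s)) ->
  sum1 (fun j => f (INR j / INR N)) N <= INR N * (G 1 - G 0) + L.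
Proof.
  intros HN HL HG Hf.
  assert (Np : 0 < INR N) by (apply lt_0_INR; lia).
  eapply Rle_trans;
    [apply (sum1_telescope_le _ (fun k => INR N * G (INR k / INR N) + INR k / INR N * L))|].
  2:{ right. simpl INR. unfold Rdiv. rewrite Rmult_0_l, Rinv_r by lra. ring. }
  intros k Hk.
  assert (k1 : INR (S k) <= INR N) by (apply le_INR; lia).
  pose proof (pos_INR k) as k0.
  rewrite S_INR in *.
  set (s := INR k / INR N). set (t := (INR k + 1) / INR N).
  assert (D : t - s = / INR N) by (unfold s, t; field; lra).
  assert (0 < / INR N) by (apply Rinv_0_lt_compat; lra).
  assert (0 <= s) by (unfold s; apply Rle_mult_inv_pos; lra).
  assert (t <= 1).
  { unfold t. apply Rmult_le_reg_r with (INR N); auto.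
    unfold Rdiv; rewrite Rmult_assoc, Rinv_l; lra. }
  assert (F : (- G t) - (- G s) <= (- f t + L * / INR N) * (t - s)).
  { apply increment_le with (f := fun x => - G x) (df := fun x => - f x); [lra| |].
    - intros x Hx. apply (is_derive_opp (V := R_NormedModule)). apply HG; lra.
    - intros x Hx. specialize (Hf x t ltac:(lra) ltac:(lra)).
      assert (L * (t - x) <= L * / INR N) by (apply Rmult_le_compat_l; lra). lra. }
  rewrite D in F.
  assert (INR N * / INR N = 1) by (apply Rinv_r; lra).
  assert (E : INR N * (- G t - - G s) <= INR N * ((- f t + L * / INR N) * / INR N))
    by (apply Rmult_le_compat_l; lra).
  replace (INR N * ((- f t + L * / INR N) * / INR N)) with (- f t + L * / INR N) in E
    by (field; lra).
  replace (t * L) with (s * L + L * / INR N) by (rewrite <- D; ring).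
  lra.
Qed.

(** The summand is Re e^((a + ib)s), with antiderivative Re (e^((a + ib)s) / (a + ib)). For a = kx
    and b = ky the error is proportional to k, so the weight 1/k of the logarithmic series makes it
    independent of k. *)
Lemma riemann_sum_exp_cos (a b : R) (N : nat) :
  (1 <= N)%nat -> a <= 0 -> 0 < a * a + b * b ->
  sum1 (fun j => exp (a * (INR j / INR N)) * cos (b * (INR j / INR N))) N <=
  INR N * ((exp a * (a * cos b + b * sin b) - a) / (a * a + b * b)) + (Rabs a + Rabs b).
Proof.
  intros HN Ha Hab.
  pose proof (riemann_sum_le (fun s => exp (a * s) * cos (b * s))
    (fun s => exp (a * s) * (a * cos (b * s) + b * sin (b * s)) / (a * a + b * b))
    (Rabs a + Rabs b) N HN) as H.
  cbv beta in H.
  rewrite !Rmult_0_r, !Rmult_1_r, exp_0, cos_0, sin_0 in H.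
  replace ((exp a * (a * cos b + b * sin b) - a) / (a * a + b * b)) with
    (exp a * (a * cos b + b * sin b) / (a * a + b * b)
     - 1 * (a * 1 + b * 0) / (a * a + b * b)) by (field; lra).
  apply H.
  - pose proof (Rabs_pos a); pose proof (Rabs_pos b); lra.
  - intros s Hs. auto_derive; [lra|]. field; lra.
  - intros s t Hs Ht.
    apply increment_le with (f := fun s => exp (a * s) * cos (b * s))
      (df := fun s => exp (a * s) * (a * cos (b * s) - b * sin (b * s))); [lra| |].
    + intros x Hx. auto_derive; auto; ring.
    + intros x Hx.
      assert (E : 0 < exp (a * x) <= 1).
      { split; [apply exp_pos|]. rewrite <- exp_0. apply exp_le_exp; nra. }
      assert (a * cos (b * x) <= Rabs a).
      { pose proof (COS_bound (b * x)). rewrite (Rabs_left1 a) by lra. nra. }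
      assert (- (b * sin (b * x)) <= Rabs b).
      { pose proof (SIN_bound (b * x)). unfold Rabs; destruct (Rcase_abs b); nra. }
      pose proof (Rabs_pos a); pose proof (Rabs_pos b). nra.
Qed.

Lemma sum_inv_sqrt_le (N : nat) : sum1 (fun j => / sqrt (INR j)) N <= 2 * sqrt (INR N).
Proof.
  eapply Rle_trans; [apply (sum1_telescope_le _ (fun n => 2 * sqrt (INR n)))|].
  2:{ right. simpl INR. rewrite sqrt_0; ring. }
  intros k _.
  rewrite S_INR. pose proof (pos_INR k) as Hk.
  assert (Hs : 0 < sqrt (INR k + 1)) by (apply sqrt_lt_R0; lra).
  pose proof (sqrt_pos (INR k)).
  assert (sqrt (INR k + 1) * sqrt (INR k + 1) = INR k + 1) by (apply sqrt_sqrt; lra).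
  assert (sqrt (INR k) * sqrt (INR k) = INR k) by (apply sqrt_sqrt; lra).
  apply Rmult_le_reg_r with (sqrt (INR k + 1)); auto.
  rewrite Rinv_l by lra. nra.
Qed.

Lemma one_minus_exp_neg_ge (u : R) : 0 <= u -> u / (1 + u) <= 1 - exp (- u).
Proof.
  intros Hu. rewrite exp_Ropp. pose proof (exp_ineq1_le u).
  assert (/ exp u <= / (1 + u)) by (apply Rinv_le_contravar; lra).
  replace (u / (1 + u)) with (1 - / (1 + u)) by (field; lra). lra.
Qed.

(** The inequality 1 - e^(-u) >= u/(1 + u) turns each summand into a constant times sqrt(N/j), and
    the sum of 1/sqrt(j) is O(sqrt N). *)
Lemma sum_inv_sqrt_one_minus_exp (del B x : R) (N : nat) :
  (1 <= N)%nat -> 0 < del -> del <= - x <= B ->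
  sum1 (fun j => / sqrt (1 - exp (x * (INR j / INR N)))) N
  <= 2 * sqrt ((1 + B) / del) * INR N.
Proof.
  intros HN Hd Hx.
  assert (Np : 0 < INR N) by (apply lt_0_INR; lia).
  set (M := (1 + B) / del).
  assert (HM : 0 < M) by (unfold M; apply Rdiv_lt_0_compat; lra).
  apply Rle_trans with (sum1 (fun j => sqrt M * sqrt (INR N) * / sqrt (INR j)) N).
  - apply sum1_le; intros j Hj.
    assert (jp : 0 < INR j) by (apply lt_0_INR; lia).
    assert (jn : INR j <= INR N) by (apply le_INR; lia).
    set (t := INR j / INR N).
    assert (t0 : 0 < t) by (unfold t; apply Rdiv_lt_0_compat; lra).
    assert (t1 : t <= 1).
    { unfold t. apply Rmult_le_reg_r with (INR N); auto.
      unfold Rdiv; rewrite Rmult_assoc, Rinv_l; lra. }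
    pose proof (one_minus_exp_neg_ge (- x * t) ltac:(nra)) as E.
    replace (- (- x * t)) with (x * t) in E by ring.
    assert (L : t / M <= 1 - exp (x * t)).
    { apply Rle_trans with (2 := E).
      replace (t / M) with (t * del / (1 + B)) by (unfold M; field; lra).
      apply Rmult_le_compat; [nra| | nra |].
      - left; apply Rinv_0_lt_compat; lra.
      - apply Rinv_le_contravar; nra. }
    assert (P : 0 < t / M) by (apply Rdiv_lt_0_compat; lra).
    apply Rle_trans with (/ sqrt (t / M)).
    + apply Rinv_le_contravar; [apply sqrt_lt_R0; auto|apply sqrt_le_1; lra].
    + right. unfold t.
      assert (0 < sqrt M) by (apply sqrt_lt_R0; lra).
      assert (0 < sqrt (INR N)) by (apply sqrt_lt_R0; lra).
      assert (0 < sqrt (INR j)) by (apply sqrt_lt_R0; lra).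
      rewrite !sqrt_div_alt by lra. field; repeat split; lra.
  - rewrite sum1_scal. pose proof (sum_inv_sqrt_le N).
    assert (0 <= sqrt M) by apply sqrt_pos.
    assert (0 <= sqrt (INR N)) by apply sqrt_pos.
    assert (sqrt (INR N) * sqrt (INR N) = INR N) by (apply sqrt_sqrt; lra).
    replace (2 * sqrt M * INR N) with (sqrt M * sqrt (INR N) * (2 * sqrt (INR N)))
      by (rewrite <- H2 at 3; ring).
    apply Rmult_le_compat_l; [nra|auto].
Qed.

(* For [x < 0] and [K] tending to infinity this is the real part of
   [(Li2 (e^z) - Li2 1) / z] at [z = x + i y], the exponential growth rate of
   [1 / (e^(z/N))_N]. *)
Definition growth (x y : R) (K : nat) : R :=
  sum1 (fun k => (- x * (1 - exp x ^ k * cos (INR k * y))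
                  + y * (exp x ^ k * sin (INR k * y))) / (INR k * INR k)) K
  / (x * x + y * y).

(** [K] and [C] are fixed before [N], [x] and [y], so the estimate is uniform along the contour. The
    double sum over j and k is exchanged, and each inner sum over j is a Riemann sum. *)
Lemma neg_ln_product_le (del B eta : R) :
  0 < del -> 0 < B -> 0 < eta ->
  exists (K : nat) (C : R), (1 <= K)%nat /\
  forall N x y, (1 <= N)%nat -> del <= - x <= B -> Rabs y <= B ->
  - sum1 (fun j => ln (dist1 (exp (x * (INR j / INR N))) (y * (INR j / INR N))) / 2) N
  <= INR N * (growth x y K + eta) + C.
Proof.
  intros Hd HB He.
  set (M := sqrt ((1 + B) / del)).
  assert (HM : 0 < M) by (apply sqrt_lt_R0, Rdiv_lt_0_compat; lra).
  (* The remainders add up to at most [2 * eps * (2 * M * INR N)], which this choice makes equal to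
     [INR N * eta]. *)
  set (eps := eta / (4 * M)).
  assert (Hep : 0 < eps) by (apply Rdiv_lt_0_compat; lra).
  destruct (INR_unbounded (/ (eps * eps))) as [K HK].
  assert (HK1 : 1 <= INR K * (eps * eps)).
  { apply Rmult_le_reg_r with (/ (eps * eps)); [apply Rinv_0_lt_compat; nra|].
    rewrite Rmult_assoc, Rinv_r by nra; lra. }
  (* Each of the [K] frequencies costs a Riemann sum error of (k|x| + k|y|)/k <= 2B. *)
  exists K, (INR K * (2 * B)).
  split.
  { destruct K; [simpl in HK1; lra|lia]. }
  intros N x y HN Hx Hy.
  assert (Np : 0 < INR N) by (apply lt_0_INR; lia).
  apply Rle_trans with (sum1 (fun j =>
    sum1 (fun k => / INR k * (exp (INR k * x * (INR j / INR N))
                              * cos (INR k * y * (INR j / INR N)))) K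
    + 2 * eps * / sqrt (1 - exp (x * (INR j / INR N)))) N).
  - replace (- sum1 _ N) with (-1 * sum1 (fun j =>
      ln (dist1 (exp (x * (INR j / INR N))) (y * (INR j / INR N))) / 2) N) by ring.
    rewrite <- sum1_scal. apply sum1_le; intros j Hj.
    assert (jp : 0 < INR j) by (apply lt_0_INR; lia).
    set (t := INR j / INR N).
    assert (t0 : 0 < t) by (unfold t; apply Rdiv_lt_0_compat; lra).
    assert (0 <= exp (x * t) < 1).
    { split; [left; apply exp_pos|]. rewrite <- exp_0. apply exp_increasing; nra. }
    pose proof (neg_ln_dist1_le (exp (x * t)) (y * t) eps K H Hep HK1) as E.
    rewrite (sum1_ext _ (fun k => / INR k * (exp (INR k * x * t) * cos (INR k * y * t)))) in E.
    + lra.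
    + intros k _. rewrite <- exp_INR_mult, <- !Rmult_assoc. unfold Rdiv; ring.
  - rewrite sum1_plus, sum1_swap, sum1_scal.
    pose proof (sum_inv_sqrt_one_minus_exp del B x N HN Hd Hx) as T. fold M in T.
    assert (2 * eps * sum1 (fun j => / sqrt (1 - exp (x * (INR j / INR N)))) N
            <= INR N * eta).
    { replace (INR N * eta) with (2 * eps * (2 * M * INR N)) by (unfold eps; field; lra).
      apply Rmult_le_compat_l; lra. }
    assert (sum1 (fun k => sum1 (fun j => / INR k * (exp (INR k * x * (INR j / INR N))
                              * cos (INR k * y * (INR j / INR N)))) N) K
            <= INR N * growth x y K + INR K * (2 * B)); [|lra].
    apply Rle_trans with (sum1 (fun k =>
      INR N * / (x * x + y * y) *
      ((- x * (1 - exp x ^ k * cos (INR k * y))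
                  + y * (exp x ^ k * sin (INR k * y))) / (INR k * INR k)) + 2 * B) K).
    + apply sum1_le; intros k Hk.
      assert (kp : 0 < INR k) by (apply lt_0_INR; lia).
      rewrite sum1_scal.
      pose proof (riemann_sum_exp_cos (INR k * x) (INR k * y) N HN ltac:(nra)) as Q.
      assert (D : 0 < INR k * x * (INR k * x) + INR k * y * (INR k * y)).
      { replace (INR k * x * (INR k * x) + INR k * y * (INR k * y)) with
          ((INR k * INR k) * (x * x + y * y)) by ring.
        apply Rmult_lt_0_compat; nra. }
      specialize (Q D).
      rewrite !Rabs_mult, (Rabs_right (INR k)), (Rabs_left x) in Q by lra.
      rewrite exp_INR_mult in Q.
      apply Rmult_le_compat_l with (r := / INR k) in Q; [|left; apply Rinv_0_lt_compat; lra].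
      apply Rle_trans with (1 := Q).
      rewrite Rmult_plus_distr_l.
      apply Rplus_le_compat.
      * right. field. repeat split; nra.
      * replace (/ INR k * (INR k * - x + INR k * Rabs y)) with (- x + Rabs y) by (field; lra).
        lra.
    + rewrite sum1_plus, sum1_scal, sum1_const. unfold growth. right. field; nra.
Qed.

(** * Numerical bounds *)

Lemma PI_bounds : 31415 / 10000 < PI < 31416 / 10000.
Proof.
  pose proof (PI_2_3_7_ineq 2) as H.
  unfold tg_alt, PI_2_3_7_tg, Ratan_seq in H.
  simpl in H. lra.
Qed.

Lemma sin_ge_cubic (u : R) : 0 <= u <= PI -> u - u ^ 3 / 6 <= sin u.
Proof.
  intros Hu. pose proof (sin_bound u 0 (proj1 Hu) (proj2 Hu)) as [H _].
  unfold sin_approx, sin_term in H. simpl in H. lra.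
Qed.

Lemma sin_le_quintic (u : R) : 0 <= u <= PI -> sin u <= u - u ^ 3 / 6 + u ^ 5 / 120.
Proof.
  intros Hu. pose proof (sin_bound u 0 (proj1 Hu) (proj2 Hu)) as [_ H].
  unfold sin_approx, sin_term in H. simpl in H. lra.
Qed.

Lemma cos_le_quartic (u : R) :
  - PI / 2 <= u <= PI / 2 -> cos u <= 1 - u ^ 2 / 2 + u ^ 4 / 24.
Proof.
  intros Hu. pose proof (cos_bound u 0 (proj1 Hu) (proj2 Hu)) as [_ H].
  unfold cos_approx, cos_term in H. simpl in H. lra.
Qed.

Lemma cos_ge_sextic (u : R) :
  - PI / 2 <= u <= PI / 2 -> 1 - u ^ 2 / 2 + u ^ 4 / 24 - u ^ 6 / 720 <= cos u.
Proof.
  intros Hu. pose proof (cos_bound u 1 (proj1 Hu) (proj2 Hu)) as [H _].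
  unfold cos_approx, cos_term in H. simpl in H. lra.
Qed.

Lemma cos_ge_quadratic (u : R) : - PI / 2 <= u <= PI / 2 -> 1 - u ^ 2 / 2 <= cos u.
Proof.
  intros Hu. pose proof (cos_bound u 0 (proj1 Hu) (proj2 Hu)) as [H _].
  unfold cos_approx, cos_term in H. simpl in H. lra.
Qed.

Lemma exp_ge_quadratic (u : R) : 0 <= u -> 1 + u + u ^ 2 / 2 <= exp u.
Proof.
  intros Hu.
  assert (H : exp 0 - (1 + 0 + 0 ^ 2 / 2) <= exp u - (1 + u + u ^ 2 / 2)).
  { apply deriv_nonneg_le with (f := fun u => exp u - (1 + u + u ^ 2 / 2))
      (df := fun u => exp u - (1 + u)); auto.
    - intros x Hx. auto_derive; auto. simpl; field.
    - intros x Hx. pose proof (exp_ineq1_le x). lra. }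
  rewrite exp_0 in H. lra.
Qed.

Lemma exp_neg_ge_cubic (u : R) : 0 <= u -> 1 - u + u ^ 2 / 2 - u ^ 3 / 6 <= exp (- u).
Proof.
  assert (Q : forall u, 0 <= u -> exp (- u) <= 1 - u + u ^ 2 / 2).
  { intros v Hv.
    assert (H : 1 - 0 + 0 ^ 2 / 2 - exp (- 0) <= 1 - v + v ^ 2 / 2 - exp (- v)).
    { apply deriv_nonneg_le with (f := fun u => 1 - u + u ^ 2 / 2 - exp (- u))
        (df := fun u => -1 + u + exp (- u)); auto.
      - intros x Hx. auto_derive; auto. simpl; field.
      - intros x Hx. pose proof (exp_ineq1_le (- x)). lra. }
    rewrite Ropp_0, exp_0 in H. lra. }
  intros Hu.
  assert (H : exp (- 0) - (1 - 0 + 0 ^ 2 / 2 - 0 ^ 3 / 6)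
              <= exp (- u) - (1 - u + u ^ 2 / 2 - u ^ 3 / 6)).
  { apply deriv_nonneg_le with (f := fun u => exp (- u) - (1 - u + u ^ 2 / 2 - u ^ 3 / 6))
      (df := fun u => 1 - u + u ^ 2 / 2 - exp (- u)); auto.
    - intros x Hx. auto_derive; auto. simpl; field.
    - intros x Hx. pose proof (Q x (proj1 Hx)). lra. }
  rewrite Ropp_0, exp_0 in H. lra.
Qed.

(** Argument reduction: the quadratic Taylor bound is applied at a small [v] and raised to the power
    [n], which leaves an inequality between rational numbers. *)
Lemma exp_neg_le_of_power (u v b : R) (n : nat) :
  (1 <= n)%nat -> 0 <= v -> INR n * v <= u ->
  0 < b -> 1 <= b * (1 + v + v ^ 2 / 2) ^ n -> exp (- u) <= b.
Proof.
  intros Hn Hv Hu Hb H.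
  apply Rle_trans with (exp (- (INR n * v))); [apply exp_le_exp; lra|].
  rewrite exp_Ropp, exp_INR_mult.
  assert (Q : (1 + v + v ^ 2 / 2) ^ n <= exp v ^ n).
  { apply pow_incr. pose proof (exp_ge_quadratic v Hv). nra. }
  assert (0 < exp v ^ n) by (apply pow_lt, exp_pos).
  apply Rmult_le_reg_r with (exp v ^ n); auto.
  rewrite Rinv_l by lra. nra.
Qed.

Lemma exp_neg_ge_of_power (u v b : R) (n : nat) :
  0 <= v <= 1 -> u <= INR n * v -> b <= (1 - v + v ^ 2 / 2 - v ^ 3 / 6) ^ n -> b <= exp (- u).
Proof.
  intros Hv Hu H.
  apply Rle_trans with (exp (INR n * - v)); [|apply exp_le_exp; lra].
  rewrite exp_INR_mult. apply Rle_trans with (1 := H).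
  apply pow_incr. split; [nra|apply exp_neg_ge_cubic; lra].
Qed.

(** The modulus of 1 - w0 is near 0.2008 and its argument near 1.14, so the ratio is about
    -1.6055/7.4234 = -0.2163. Locating the logarithm within 0.02 and the argument within 0.1 is
    enough for the stated interval. *)
Lemma w0_argument_bounds (w0 : Cx) :
  Cnorm (Csub w0 w0_approx) < / 10000000 ->
  -219 / 1000 <= Re (c_of w0) <= -212 / 1000 /\ Im (c_of w0) = 1.
Proof.
  intros H. destruct w0 as [a b].
  assert (Hab : 838 / 10000 <= 1 - a <= 83803 / 1000000 /\ 18245 / 100000 <= - b <= 18247 / 100000).
  { unfold Cnorm, Cnorm2, Csub, Cadd, Copp, w0_approx in H; simpl in H.
    set (p := a + - (91619782 / 100000000)) in *.
    set (q := b + - - (18245890 / 100000000)) in *.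
    assert (Hp : 0 <= p * p + q * q) by nra.
    assert (S : p * p + q * q < / 10000000 * / 10000000).
    { rewrite <- (sqrt_sqrt _ Hp). pose proof (sqrt_pos (p * p + q * q)).
      apply Rmult_le_0_lt_compat; lra. }
    assert (- / 10000000 <= p <= / 10000000) by (split; nra).
    assert (- / 10000000 <= q <= / 10000000) by (split; nra).
    unfold p, q in *; lra. }
  destruct Hab as [Ha Hb].
  pose proof PI_bounds.
  unfold c_of, z0_of, Clog, Carg, Cnorm, Cnorm2, Csub, Cadd, Copp, Cmul, RtoC, Ci, C1; simpl.
  set (u := 1 + - a). set (v := 0 + - b).
  assert (Hu : 838 / 10000 <= u <= 83803 / 1000000) by (unfold u; lra).
  assert (Hv : 18245 / 100000 <= v <= 18247 / 100000) by (unfold v; lra).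
  destruct (Rlt_dec 0 u) as [_|]; [|lra].
  assert (N2 : 2007 / 10000 <= sqrt (u * u + v * v) <= 2009 / 10000).
  { split.
    - rewrite <- (sqrt_square (2007 / 10000)) by lra. apply sqrt_le_1; nra.
    - rewrite <- (sqrt_square (2009 / 10000)) by lra. apply sqrt_le_1; nra. }
  set (n := sqrt (u * u + v * v)) in *.
  assert (L : -1615 / 1000 <= ln n <= -1595 / 1000).
  { split.
    - rewrite <- (ln_exp (-1615 / 1000)). apply Rcomplements.ln_le; [apply exp_pos|].
      apply Rle_trans with (2007 / 10000); [|lra].
      replace (-1615 / 1000) with (- (1615 / 1000)) by field.
      apply exp_neg_le_of_power with (v := 1009 / 10000) (n := 16%nat);
        [lia|lra|simpl; lra|lra|lra].
    - rewrite <- (ln_exp (-1595 / 1000)). apply Rcomplements.ln_le; [lra|].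
      apply Rle_trans with (2009 / 10000); [lra|].
      replace (-1595 / 1000) with (- (1595 / 1000)) by field.
      apply exp_neg_ge_of_power with (v := 399 / 1000) (n := 4%nat); [lra|simpl; lra|lra]. }
  assert (Q : 217 / 100 <= v / u <= 218 / 100).
  { split; apply Rmult_le_reg_r with u; try lra; unfold Rdiv; rewrite (Rmult_assoc v), Rinv_l; lra. }
  (* The values tan 1.1, about 1.96, and tan 1.2, about 2.57, lie on either side of v/u, which is
     about 2.18. *)
  assert (T : 11 / 10 <= atan (v / u) <= 12 / 10).
  { split.
    - rewrite <- (atan_tan (11 / 10)) by lra.
      destruct (Rle_lt_or_eq_dec (tan (11 / 10)) (v / u)) as [E|E];
        [|left; apply atan_increasing; auto|right; rewrite E; auto].
      apply Rle_trans with (217 / 100); [|lra].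
      pose proof (sin_le_quintic (11 / 10) ltac:(lra)).
      pose proof (cos_ge_sextic (11 / 10) ltac:(lra)).
      assert (0 < cos (11 / 10)) by lra.
      unfold tan. apply Rmult_le_reg_r with (cos (11 / 10)); auto.
      replace (sin (11 / 10) / cos (11 / 10) * cos (11 / 10)) with (sin (11 / 10))
        by (field; lra). lra.
    - rewrite <- (atan_tan (12 / 10)) by lra.
      destruct (Rle_lt_or_eq_dec (v / u) (tan (12 / 10))) as [E|E];
        [|left; apply atan_increasing; auto|right; rewrite E; auto].
      apply Rle_trans with (218 / 100); [lra|].
      pose proof (sin_ge_cubic (12 / 10) ltac:(lra)).
      pose proof (cos_le_quartic (12 / 10) ltac:(lra)).
      assert (0 < cos (12 / 10)) by (apply cos_gt_0; lra).
      unfold tan. apply Rmult_le_reg_r with (cos (12 / 10)); auto.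
      replace (sin (12 / 10) / cos (12 / 10) * cos (12 / 10)) with (sin (12 / 10))
        by (field; lra). lra. }
  set (th := atan (v / u)) in *. set (l := ln n) in *.
  split; [|reflexivity].
  set (im := 2 * PI * 1 + 0 * 0 + th).
  assert (Him : 738 / 100 <= im <= 749 / 100) by (unfold im; lra).
  replace (2 * PI * 0 - 0 * 1 + l) with l by ring.
  assert (im <> 0) by lra. clearbody im.
  assert (E : l / im * im = l) by (field; auto).
  split; apply Rmult_le_reg_r with im; lra.
Qed.

(** The limit is pi^2/6 = 1.64493... The first six terms are at most 1.4914, and 1/k^2 <= 1/(k -
    1/2) - 1/(k + 1/2) telescopes the others to at most 2/13. Padding with six more terms avoids a
    separate treatment of small [K]. *)
Lemma sum_inv_sq_le (K : nat) : sum1 (fun k => / (INR k * INR k)) K <= 16454 / 10000.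
Proof.
  assert (P : forall k, (1 <= k)%nat -> 0 < / (INR k * INR k)).
  { intros k Hk. assert (0 < INR k) by (apply lt_0_INR; lia).
    apply Rinv_0_lt_compat; nra. }
  apply Rle_trans with (sum1 (fun k => / (INR k * INR k)) (6 + K)).
  - replace (6 + K)%nat with (K + 6)%nat by lia.
    generalize 6%nat as d; intros d; induction d as [|d IH].
    + rewrite Nat.add_0_r; lra.
    + rewrite Nat.add_succ_r; cbn [sum1]. specialize (P (S (K + d)) ltac:(lia)). lra.
  - enough (sum1 (fun k => / (INR k * INR k)) (6 + K)
            <= 14914 / 10000 + 2 / 13 - / (INR K + 13 / 2)).
    { assert (0 < / (INR K + 13 / 2))
        by (apply Rinv_0_lt_compat; pose proof (pos_INR K); lra). lra. }
    induction K as [|K IH]; [simpl; lra|].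
    replace (6 + S K)%nat with (S (6 + K)) by lia.
    cbn [sum1]. replace (INR (S (6 + K))) with (INR K + 7)
      by (rewrite S_INR, plus_INR; simpl; ring).
    rewrite S_INR. pose proof (pos_INR K).
    assert (/ ((INR K + 7) * (INR K + 7)) <= / (INR K + 13 / 2) - / (INR K + 1 + 13 / 2)).
    { replace (/ (INR K + 13 / 2) - / (INR K + 1 + 13 / 2)) with
        (/ ((INR K + 13 / 2) * (INR K + 1 + 13 / 2))) by (field; lra).
      apply Rinv_le_contravar; nra. }
    simpl Nat.add in *. lra.
Qed.

(** The constant 0.6454 bounds the sum of 1/k^2 over k >= 2. The first term stays exact because its
    sign is what the later estimates exploit. *)
Lemma sum1_le_first_plus_tail (f : nat -> R) (c : R) (K : nat) :
  (1 <= K)%nat -> 0 <= c -> (forall k, (2 <= k)%nat -> f k <= c / (INR k * INR k)) ->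
  sum1 f K <= f 1%nat + 6454 / 10000 * c.
Proof.
  intros HK Hc Hf.
  enough (sum1 f K <= f 1%nat + c * (sum1 (fun k => / (INR k * INR k)) K - 1))
    by (pose proof (sum_inv_sq_le K); nra).
  destruct K as [|K]; [lia|]. clear HK.
  induction K as [|K IH]; [simpl; lra|].
  change (sum1 f (S (S K))) with (sum1 f (S K) + f (S (S K))).
  change (sum1 (fun k => / (INR k * INR k)) (S (S K))) with
    (sum1 (fun k => / (INR k * INR k)) (S K) + / (INR (S (S K)) * INR (S (S K)))).
  specialize (Hf (S (S K)) ltac:(lia)). unfold Rdiv in Hf. lra.
Qed.

(** * The growth rate along the contour *)

Lemma pow_le_sq (r : R) (k : nat) : 0 <= r <= 1 -> (2 <= k)%nat -> 0 <= r ^ k <= r * r.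
Proof.
  intros Hr Hk. split; [apply pow_le; lra|].
  destruct k as [|[|k]]; try lia. simpl.
  assert (r ^ k <= 1) by (rewrite <- (pow1 k); apply pow_incr; lra).
  rewrite <- Rmult_assoc. rewrite <- (Rmult_1_r (r * r)) at 2.
  apply Rmult_le_compat_l; nra.
Qed.

Lemma exp_neg_bounds (x : R) : x < 0 -> 0 < exp x <= 1.
Proof. split; [apply exp_pos|]. rewrite <- exp_0. apply exp_le_exp; lra. Qed.

(** Only k = 1 is kept exactly; from k = 2 on, sine and cosine take their worst values and r^k is
    replaced by r^2. *)
Lemma growth_le_crude (x y : R) (K : nat) :
  (1 <= K)%nat -> x < 0 -> 0 <= y ->
  growth x y K <=
  (- x * (1 - exp x * cos y) + y * (exp x * sin y)
   + 6454 / 10000 * (- x * (1 + exp x * exp x) + y * (exp x * exp x))) / (x * x + y * y).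
Proof.
  intros HK Hx Hy. unfold growth.
  apply Rmult_le_compat_r; [left; apply Rinv_0_lt_compat; nra|].
  pose proof (exp_neg_bounds x Hx) as Hr. set (r := exp x) in *.
  eapply Rle_trans; [apply sum1_le_first_plus_tail with
    (c := - x * (1 + r * r) + y * (r * r)); [auto|nra|]|].
  - intros k Hk. assert (0 < INR k) by (apply lt_0_INR; lia).
    apply Rmult_le_compat_r; [left; apply Rinv_0_lt_compat; nra|].
    pose proof (pow_le_sq r k ltac:(lra) Hk).
    pose proof (COS_bound (INR k * y)). pose proof (SIN_bound (INR k * y)).
    apply Rplus_le_compat; apply Rmult_le_compat_l; nra.
  - simpl. rewrite (Rmult_1_l y). right; field.
Qed.

Lemma Rabs_sin_INR_le (k : nat) (y : R) : Rabs (sin (INR k * y)) <= INR k * Rabs (sin y).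
Proof.
  induction k as [|k IH].
  - simpl; rewrite !Rmult_0_l, sin_0, Rabs_R0; lra.
  - rewrite S_INR, Rmult_plus_distr_r, Rmult_1_l, sin_plus.
    eapply Rle_trans; [apply Rabs_triang|]. rewrite !Rabs_mult.
    assert (Rabs (cos y) <= 1) by (apply Rabs_le; apply COS_bound).
    assert (Rabs (cos (INR k * y)) <= 1) by (apply Rabs_le; apply COS_bound).
    pose proof (Rabs_pos (sin y)). pose proof (Rabs_pos (sin (INR k * y))). nra.
Qed.

(** The full series is -ln(1 - r), which stays below 2r up to about r = 0.797. The limit 0.74 covers
    e^(-pi/10), the largest |e^z| on L3. Three terms are kept and later denominators replaced by 4,
    leaving a geometric tail. *)
Lemma sum_pow_div_le (r : R) (K : nat) :
  0 <= r <= 74 / 100 -> sum1 (fun k => r ^ k / INR k) K <= 2 * r.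
Proof.
  intros Hr.
  assert (P : forall k, (1 <= k)%nat -> 0 <= r ^ k / INR k).
  { intros k Hk. apply Rle_mult_inv_pos; [apply pow_le; lra|apply lt_0_INR; lia]. }
  apply Rle_trans with (sum1 (fun k => r ^ k / INR k) (3 + K)).
  - replace (3 + K)%nat with (K + 3)%nat by lia.
    generalize 3%nat as d; intros d; induction d as [|d IH].
    + rewrite Nat.add_0_r; lra.
    + rewrite Nat.add_succ_r; cbn [sum1]. specialize (P (S (K + d)) ltac:(lia)). lra.
  - assert (I : 0 < / (1 - r)) by (apply Rinv_0_lt_compat; lra).
    assert (E : sum1 (fun k => r ^ k / INR k) (3 + K)
            <= r + r ^ 2 / 2 + r ^ 3 / 3 + (r ^ 4 - r ^ (4 + K)) * / (1 - r) / 4).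
    { induction K as [|K IH]; [simpl; lra|].
      replace (3 + S K)%nat with (S (3 + K)) by lia.
      change (sum1 (fun k => r ^ k / INR k) (S (3 + K))) with
        (sum1 (fun k => r ^ k / INR k) (3 + K) + r ^ (S (3 + K)) / INR (S (3 + K))).
      replace (4 + S K)%nat with (S (S (3 + K))) by lia.
      replace (4 + K)%nat with (S (3 + K)) in IH by lia.
      assert (0 <= r ^ S (3 + K)) by (apply pow_le; lra).
      assert (r ^ S (3 + K) / INR (S (3 + K)) <= r ^ S (3 + K) / 4).
      { apply Rmult_le_compat_l; auto. apply Rinv_le_contravar; [lra|].
        rewrite S_INR, plus_INR. pose proof (pos_INR K). simpl; lra. }
      change (r ^ S (S (3 + K))) with (r * r ^ S (3 + K)).
      set (w := r ^ S (3 + K)) in *.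
      assert ((r ^ 4 - r * w) * / (1 - r) / 4 = (r ^ 4 - w) * / (1 - r) / 4 + w / 4)
        by (field; lra).
      lra. }
    assert (0 <= r ^ (4 + K)) by (apply pow_le; lra).
    assert (I4 : / (1 - r) <= / (26 / 100)) by (apply Rinv_le_contravar; lra).
    apply Rle_trans with (1 := E).
    assert (0 <= r ^ 4) by (apply pow_le; lra).
    assert ((r ^ 4 - r ^ (4 + K)) * / (1 - r) <= r ^ 4 * / (26 / 100)) by nra.
    assert (r ^ 2 / 2 + r ^ 3 / 3 + r ^ 4 / (26 / 100) / 4
            <= r * (74 / 100 / 2 + (74 / 100) ^ 2 / 3 + (74 / 100) ^ 3 / (26 / 100) / 4)).
    { assert (r * r <= 74 / 100 * (74 / 100)) by nra.
      assert (r * r * r <= 74 / 100 * (74 / 100) * (74 / 100)) by (apply Rmult_le_compat; nra).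
      simpl. nra. }
    lra.
Qed.

(** By |sin(ky)| <= k |sin y| the terms from k = 2 on are at most |sin y| r^k/k, and these sum to at
    most r |sin y| by [sum_pow_div_le]; the nonpositive first term outweighs them. *)
Lemma sum_pow_sin_nonpos (r y : R) (K : nat) :
  (1 <= K)%nat -> 0 <= r <= 74 / 100 -> sin y <= 0 ->
  sum1 (fun k => r ^ k * sin (INR k * y) / (INR k * INR k)) K <= 0.
Proof.
  intros HK Hr Hs.
  enough (sum1 (fun k => r ^ k * sin (INR k * y) / (INR k * INR k)) K
          <= - sin y * (sum1 (fun k => r ^ k / INR k) K - 2 * r))
    by (pose proof (sum_pow_div_le r K Hr); nra).
  destruct K as [|K]; [lia|]. clear HK.
  induction K as [|K IH].
  - simpl. rewrite (Rmult_1_l y). lra.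
  - change (sum1 (fun k => r ^ k * sin (INR k * y) / (INR k * INR k)) (S (S K))) with
      (sum1 (fun k => r ^ k * sin (INR k * y) / (INR k * INR k)) (S K)
       + r ^ S (S K) * sin (INR (S (S K)) * y) / (INR (S (S K)) * INR (S (S K)))).
    change (sum1 (fun k => r ^ k / INR k) (S (S K))) with
      (sum1 (fun k => r ^ k / INR k) (S K) + r ^ S (S K) / INR (S (S K))).
    set (k := S (S K)) in *.
    assert (kp : 0 < INR k) by (apply lt_0_INR; unfold k; lia).
    assert (r ^ k * sin (INR k * y) / (INR k * INR k) <= - sin y * (r ^ k / INR k)).
    { replace (- sin y * (r ^ k / INR k)) with
        (r ^ k * (INR k * - sin y) / (INR k * INR k)) by (field; lra).
      apply Rmult_le_compat_r; [left; apply Rinv_0_lt_compat; nra|].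
      apply Rmult_le_compat_l; [apply pow_le; lra|].
      pose proof (Rabs_sin_INR_le k y) as Q. rewrite (Rabs_left1 (sin y)) in Q by auto.
      pose proof (Rle_abs (sin (INR k * y))). lra. }
    lra.
Qed.

(** Meant for the end of L3: near 2 pi c the factor sin y is almost 0 and no longer offsets the tail
    y r^2 of [growth_le_crude], which is too weak there. *)
Lemma growth_le_sin_nonpos (x y : R) (K : nat) :
  (1 <= K)%nat -> x < 0 -> exp x <= 74 / 100 -> 0 <= y -> sin y <= 0 ->
  growth x y K <=
  - x * (1 - exp x * cos y + 6454 / 10000 * (1 + exp x * exp x)) / (x * x + y * y).
Proof.
  intros HK Hx Hr Hy Hs. unfold growth.
  apply Rmult_le_compat_r; [left; apply Rinv_0_lt_compat; nra|].
  pose proof (exp_neg_bounds x Hx) as Hr'. set (r := exp x) in *.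
  rewrite (sum1_ext _ (fun k => - x * ((1 - r ^ k * cos (INR k * y)) / (INR k * INR k))
       + y * (r ^ k * sin (INR k * y) / (INR k * INR k)))).
  2:{ intros k Hk. assert (0 < INR k) by (apply lt_0_INR; lia). field; lra. }
  rewrite sum1_plus, !sum1_scal.
  pose proof (sum_pow_sin_nonpos r y K HK ltac:(lra) Hs) as Q.
  assert (P : sum1 (fun k => (1 - r ^ k * cos (INR k * y)) / (INR k * INR k)) K
          <= 1 - r * cos y + 6454 / 10000 * (1 + r * r)); [|nra].
  eapply Rle_trans; [apply sum1_le_first_plus_tail with (c := 1 + r * r); [auto|nra|]|].
  - intros k Hk. assert (0 < INR k) by (apply lt_0_INR; lia).
    apply Rmult_le_compat_r; [left; apply Rinv_0_lt_compat; nra|].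
    pose proof (pow_le_sq r k ltac:(lra) Hk).
    pose proof (COS_bound (INR k * y)). nra.
  - simpl. rewrite (Rmult_1_l y). right; field.
Qed.

Lemma Rdiv_le_of_le_mul (a b c : R) : 0 < b -> a <= c * b -> a / b <= c.
Proof.
  intros Hb H. apply Rmult_le_reg_r with b; auto.
  unfold Rdiv; rewrite Rmult_assoc, Rinv_l; lra.
Qed.

Lemma sin_2PI_minus (v : R) : sin (2 * PI - v) = - sin v.
Proof. rewrite sin_minus, sin_2PI, cos_2PI; ring. Qed.

Lemma cos_2PI_minus (v : R) : cos (2 * PI - v) = cos v.
Proof. rewrite cos_minus, sin_2PI, cos_2PI; ring. Qed.

Lemma growth_on_L2 (x : R) (K : nat) :
  (1 <= K)%nat -> - (PI / 10) <= x <= - (2 / 10) -> growth x (8 * PI / 5) K <= 495 / 10000.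
Proof.
  intros HK Hx. pose proof PI_bounds as HP.
  apply Rle_trans with (1 := growth_le_crude x (8 * PI / 5) K HK ltac:(lra) ltac:(lra)).
  apply Rdiv_le_of_le_mul; [nra|].
  pose proof (exp_neg_bounds x ltac:(lra)) as Hr. set (r := exp x) in *.
  set (y := 8 * PI / 5). assert (Hy : 5 <= y <= 504 / 100) by (unfold y; lra).
  assert (Hs : sin y <= - (9 / 10)).
  { replace y with (2 * PI - 2 * PI / 5) by (unfold y; field). rewrite sin_2PI_minus.
    pose proof (sin_ge_cubic (2 * PI / 5) ltac:(lra)).
    set (u := 2 * PI / 5) in *.
    assert (1256 / 1000 <= u <= 1257 / 1000) by (unfold u; lra).
    assert (u ^ 3 <= (1257 / 1000) ^ 3) by (apply pow_incr; lra). lra. }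
  pose proof (COS_bound y).
  assert (y * (r * sin y) + 6454 / 10000 * (y * (r * r)) <= 0).
  { replace (y * (r * sin y) + 6454 / 10000 * (y * (r * r))) with
      (y * r * (sin y + 6454 / 10000 * r)) by ring.
    assert (0 <= y * r) by nra. nra. }
  assert (- x * (1 - r * cos y) <= - x * 2) by (apply Rmult_le_compat_l; nra).
  assert (- x * (1 + r * r) <= - x * 2) by (apply Rmult_le_compat_l; nra).
  nra.
Qed.

Lemma growth_on_L3 (a t : R) (K : nat) :
  (1 <= K)%nat -> -219 / 1000 <= a <= -212 / 1000 -> 0 <= t <= 1 ->
  growth (- (PI / 10) + t * (2 * PI * a + PI / 10)) (8 * PI / 5 + t * (2 * PI - 8 * PI / 5)) K
  <= 495 / 10000.
Proof.
  intros HK Ha Ht. pose proof PI_bounds as HP.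
  set (xi := 1 / 10 + t * (- 2 * a - 1 / 10)). set (et := 16 / 10 + t * (4 / 10)).
  replace (- (PI / 10) + t * (2 * PI * a + PI / 10)) with (- (PI * xi)) by (unfold xi; field).
  replace (8 * PI / 5 + t * (2 * PI - 8 * PI / 5)) with (PI * et) by (unfold et; field).
  assert (Hxi : 1 / 10 + t * (324 / 1000) <= xi <= 1 / 10 + t * (338 / 1000)) by (unfold xi; nra).
  assert (Het : 16 / 10 <= et <= 2) by (unfold et; lra).
  set (v := PI * (4 / 10) * (1 - t)).
  assert (Ev : PI * et = 2 * PI - v) by (unfold v, et; field).
  assert (Hv : 0 <= v <= PI * (4 / 10)) by (unfold v; split; nra).
  assert (Hsin : sin (PI * et) <= 0).
  { rewrite Ev, sin_2PI_minus. pose proof (sin_ge_0 v ltac:(lra) ltac:(lra)). lra. }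
  assert (Hr : exp (- (PI * xi)) <= 74 / 100).
  { apply exp_neg_le_of_power with (v := 314 / 1000) (n := 1%nat); [lia|lra| |lra|lra].
    simpl. nra. }
  pose proof (growth_le_sin_nonpos (- (PI * xi)) (PI * et) K HK ltac:(nra) Hr ltac:(nra) Hsin) as G.
  apply Rle_trans with (1 := G). clear G.
  apply Rdiv_le_of_le_mul; [nra|].
  rewrite Ev, cos_2PI_minus, <- Ev.
  pose proof (exp_neg_bounds (- (PI * xi)) ltac:(nra)) as Hr0.
  pose proof (cos_ge_quadratic v ltac:(lra)) as Hc.
  assert (Hr1 : forall u w b n, 0 <= w <= 1 -> xi <= u -> 31416 / 10000 * u <= INR n * w ->
     b <= (1 - w + w ^ 2 / 2 - w ^ 3 / 6) ^ n -> b <= exp (- (PI * xi))).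
  { intros u w b n Hw Hu Hn Hb. apply exp_neg_ge_of_power with (v := w) (n := n); auto; nra. }
  set (r := exp (- (PI * xi))) in *.
  (* The target divided by pi, in the scaled coordinates x = -pi xi and y = pi et; 0.15549 is just
     below 0.0495 pi. *)
  assert (Q : xi * (1 - r * cos v + 6454 / 10000 * (1 + r * r))
              <= 15549 / 100000 * (xi * xi + et * et)).
  2:{ replace (- (PI * xi) * - (PI * xi) + PI * et * (PI * et)) with
        (PI * PI * (xi * xi + et * et)) by ring.
      rewrite Ropp_involutive.
      apply Rle_trans with (PI * (15549 / 100000 * (xi * xi + et * et))); [nra|].
      assert (0 <= xi * xi + et * et) by nra. nra. }
  (* A quadratic in [t] below the right-hand side, against which each range of [t] is checked. *)
  assert (R : 3955 / 10000 + 206 / 1000 * t + 4 / 100 * t * t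
              <= 15549 / 100000 * (xi * xi + et * et)).
  { assert ((1 / 10 + t * (324 / 1000)) * (1 / 10 + t * (324 / 1000)) <= xi * xi)
      by (apply Rmult_le_compat; nra).
    unfold et. nra. }
  apply Rle_trans with (2 := R). clear R.
  pose proof (COS_bound v) as Hcb.
  assert (D0 : 0 <= 1 - r * cos v + 6454 / 10000 * (1 + r * r)) by nra.
  (* As [t] grows, [xi] grows but cos v approaches 1. The expression is convex in [r], so each range
     needs a lower bound for cos v and an interval for [r]: its upper end is 0.74, its lower end 0
     in the first range and otherwise given by the largest [xi]. *)
  destruct (Rle_dec t (5 / 10)) as [T1|T1]; [|destruct (Rle_dec t (8 / 10)) as [T2|T2]].
  - assert (Hcv : 2 / 10 <= cos v) by nra.
    assert (D : 1 - r * cos v + 6454 / 10000 * (1 + r * r) <= 1851 / 1000) by nra.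
    assert (xi * (1 - r * cos v + 6454 / 10000 * (1 + r * r))
            <= (1 / 10 + t * (338 / 1000)) * (1851 / 1000)) by (apply Rmult_le_compat; lra).
    nra.
  - assert (Hvv : v <= 63 / 100) by (unfold v; nra).
    assert (Hcv : 8 / 10 <= cos v) by nra.
    specialize (Hr1 (3704 / 10000) (291 / 1000) (31 / 100) 4%nat
      ltac:(lra) ltac:(lra) ltac:(simpl; lra) ltac:(lra)).
    assert (D : 1 - r * cos v + 6454 / 10000 * (1 + r * r) <= 146 / 100) by nra.
    assert (xi * (1 - r * cos v + 6454 / 10000 * (1 + r * r))
            <= (1 / 10 + t * (338 / 1000)) * (146 / 100)) by (apply Rmult_le_compat; lra).
    nra.
  - assert (Hvv : v <= 252 / 1000) by (unfold v; nra).
    assert (Hcv : 968 / 1000 <= cos v) by nra.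
    specialize (Hr1 (438 / 1000) (345 / 1000) (25 / 100) 4%nat
      ltac:(lra) ltac:(lra) ltac:(simpl; lra) ltac:(lra)).
    assert (D : 1 - r * cos v + 6454 / 10000 * (1 + r * r) <= 1445 / 1000) by nra.
    assert (xi * (1 - r * cos v + 6454 / 10000 * (1 + r * r))
            <= (1 / 10 + t * (338 / 1000)) * (1445 / 1000)) by (apply Rmult_le_compat; lra).
    nra.
Qed.

(** On the ray z = y(a + i) a factor [y] cancels, and 1 + a^2 >= 1.04 helps the denominator. Up to y
    = 4 pi the sine is nonpositive; beyond, y >= 12.5 absorbs the term r sin y <= 0.14. *)
Lemma growth_on_L5 (a et : R) (K : nat) :
  (1 <= K)%nat -> -219 / 1000 <= a <= -212 / 1000 -> 3 <= et <= 6 ->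
  growth (PI * et * a) (PI * et) K <= 495 / 10000.
Proof.
  intros HK Ha Het. pose proof PI_bounds as HP.
  set (y := PI * et). assert (Hy : 94245 / 10000 <= y) by (unfold y; nra).
  assert (Hx : y * a < 0) by nra.
  apply Rle_trans with (1 := growth_le_crude (y * a) y K HK Hx ltac:(lra)).
  apply Rdiv_le_of_le_mul; [nra|].
  assert (Hr : exp (y * a) <= 14 / 100).
  { replace (y * a) with (- (y * - a)) by ring.
    apply exp_neg_le_of_power with (v := 249 / 1000) (n := 8%nat);
      [lia|lra|simpl; nra|lra|lra]. }
  pose proof (exp_neg_bounds (y * a) Hx) as Hr0. set (r := exp (y * a)) in *.
  pose proof (COS_bound y). pose proof (SIN_bound y).
  assert (Q : - a * (1 - r * cos y) + r * sin y
          + 6454 / 10000 * (- a * (1 + r * r) + r * r) <= 495 / 10000 * y * (104 / 100)).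
  { assert (- a * (1 - r * cos y) <= 219 / 1000 * (114 / 100)) by (apply Rmult_le_compat; nra).
    assert (- a * (1 + r * r) <= 219 / 1000 * (102 / 100)) by (apply Rmult_le_compat; nra).
    assert (r * r <= 196 / 10000) by nra.
    destruct (Rle_dec et 4) as [E|E].
    - assert (sin y <= 0).
      { pose proof (sin_2PI_minus y) as E1. pose proof (sin_2PI_minus (4 * PI - y)) as E2.
        replace (2 * PI - (4 * PI - y)) with (- (2 * PI - y)) in E2 by ring.
        rewrite sin_neg in E2.
        pose proof (sin_ge_0 (4 * PI - y) ltac:(unfold y; nra) ltac:(unfold y; nra)). lra. }
      assert (r * sin y <= 0) by nra. lra.
    - assert (125 / 10 <= y) by (unfold y; nra).
      assert (r * sin y <= 14 / 100) by nra. lra. }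
  apply Rle_trans with (y * (495 / 10000 * y * (104 / 100))).
  - apply Rmult_le_compat_l with (r := y) in Q; lra.
  - assert (4 / 100 <= a * a) by nra.
    assert (0 <= y * y) by nra. nra.
Qed.

(** By 2|x|y <= x^2 + y^2 the ratio |x|/(x^2 + y^2) is at most 1/(2y) = 1/(12 pi) for every [x]; the
    other terms carry a factor e^x <= 0.02. *)
Lemma growth_on_L6 (x : R) (K : nat) :
  (1 <= K)%nat -> x <= 6 * PI * (-212 / 1000) -> growth x (6 * PI) K <= 495 / 10000.
Proof.
  intros HK Hx. pose proof PI_bounds as HP.
  set (y := 6 * PI) in *. assert (Hy : 1884 / 100 <= y) by (unfold y; lra).
  apply Rle_trans with (1 := growth_le_crude x y K HK ltac:(lra) ltac:(lra)).
  apply Rdiv_le_of_le_mul; [nra|].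
  assert (Hr : exp x <= 2 / 100).
  { replace x with (- (- x)) by ring.
    apply exp_neg_le_of_power with (v := 249 / 1000) (n := 16%nat);
      [lia|lra|simpl; nra|lra|lra]. }
  pose proof (exp_neg_bounds x ltac:(lra)) as Hr0. set (r := exp x) in *.
  pose proof (COS_bound y). pose proof (SIN_bound y).
  assert (- x * (1 - r * cos y) <= - x * (102 / 100)) by (apply Rmult_le_compat_l; nra).
  assert (- x * (1 + r * r) <= - x * (1001 / 1000)) by (apply Rmult_le_compat_l; nra).
  assert (y * (r * sin y) <= y * (2 / 100)) by (apply Rmult_le_compat_l; nra).
  assert (y * (r * r) <= y * (1 / 1000)) by (apply Rmult_le_compat_l; nra).
  assert (2 * (- x * y) <= x * x + y * y) by (pose proof (pow2_ge_0 (x + y)); nra).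
  assert (1884 / 100 * - x <= y * - x) by (apply Rmult_le_compat_r; lra).
  assert (1884 / 100 * y <= y * y) by (apply Rmult_le_compat_r; lra).
  assert (0 <= x * x) by nra.
  lra.
Qed.

Lemma growth_on_L7 (y : R) (K : nat) :
  (1 <= K)%nat -> 0 <= y <= 6 * PI -> growth (- (20 * PI)) y K <= 495 / 10000.
Proof.
  intros HK Hy. pose proof PI_bounds as HP.
  apply Rle_trans with (1 := growth_le_crude (- (20 * PI)) y K HK ltac:(lra) ltac:(lra)).
  apply Rdiv_le_of_le_mul; [nra|].
  assert (Hr : exp (- (20 * PI)) <= 2 / 100).
  { apply exp_neg_le_of_power with (v := 249 / 1000) (n := 16%nat);
      [lia|lra|simpl; nra|lra|lra]. }
  pose proof (exp_neg_bounds (- (20 * PI)) ltac:(lra)) as Hr0. set (r := exp (- (20 * PI))) in *.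
  rewrite Ropp_involutive.
  set (X := 20 * PI) in *. assert (HX : 628 / 10 <= X) by (unfold X; lra).
  assert (y <= X) by (unfold X; lra).
  pose proof (COS_bound y). pose proof (SIN_bound y).
  assert (X * (1 - r * cos y) <= X * (102 / 100)) by (apply Rmult_le_compat_l; nra).
  assert (X * (1 + r * r) <= X * (1001 / 1000)) by (apply Rmult_le_compat_l; nra).
  assert (y * (r * sin y) <= y * (2 / 100)) by (apply Rmult_le_compat_l; nra).
  assert (y * (r * r) <= y * (1 / 1000)) by (apply Rmult_le_compat_l; nra).
  assert (628 / 10 * X <= X * X) by (apply Rmult_le_compat_r; lra).
  nra.
Qed.

(** * Lower bounds for the product *)

(** Separates a radial and an angular square. The angular one survives at a = 0, which is what the
    part of L2 around x = 0 requires. *)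
Lemma dist1_sin (a b : R) :
  dist1 (exp a) b = (exp a - 1) ^ 2 + 4 * exp a * sin (b / 2) ^ 2.
Proof.
  unfold dist1. replace b with (2 * (b / 2)) at 1 by field.
  rewrite cos_2a_sin. ring.
Qed.

Lemma neg_ln_half_le (d b : R) : 0 < b -> b * b <= d -> - (ln d / 2) <= - ln b.
Proof.
  intros Hb H. assert (ln (b * b) <= ln d) by (apply Rcomplements.ln_le; nra).
  rewrite ln_mult in H0 by auto. lra.
Qed.

Lemma ln_le_pred (v : R) : 0 < v -> ln v <= v - 1.
Proof. intros Hv. pose proof (exp_ineq1_le (ln v)). rewrite exp_ln in H by auto. lra. Qed.

(** This is the weak Stirling bound N! >= (N/e)^N, obtained from a ln(1 + 1/a) <= 1. *)
Lemma sum_neg_ln_ratio (N : nat) :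
  (1 <= N)%nat -> sum1 (fun j => - ln (INR j / INR N)) N <= INR N.
Proof.
  intros HN. assert (Np : 0 < INR N) by (apply lt_0_INR; lia).
  eapply Rle_trans;
    [apply (sum1_telescope_le _ (fun n => INR n - INR n * ln (INR n / INR N)))|].
  2:{ right. unfold Rdiv. rewrite Rinv_r, ln_1 by lra. simpl; ring. }
  (* At k = 0 the value of [ln] at 0 is multiplied by 0, so it does not matter. *)
  intros k Hk. destruct k as [|k].
  - simpl INR. lra.
  - assert (kp : 0 < INR (S k)) by (apply lt_0_INR; lia).
    rewrite (S_INR (S k)). set (a := INR (S k)) in *.
    assert (E : ln ((a + 1) / INR N) = ln (a / INR N) + ln ((a + 1) / a)).
    { rewrite <- ln_mult by (apply Rdiv_lt_0_compat; lra). f_equal. field; lra. }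
    pose proof (ln_le_pred ((a + 1) / a) ltac:(apply Rdiv_lt_0_compat; lra)) as L.
    apply Rmult_le_compat_l with (r := a) in L; [|lra].
    replace (a * ((a + 1) / a - 1)) with 1 in L by (field; lra).
    rewrite E. lra.
Qed.

(** The integral of -ln(1 - 4s/5) over [0, 1] is 1 - (ln 5)/4, and 4 is the slope at s = 1. The
    factor 4/5 is y/(2 pi) for y = 8 pi/5. *)
Lemma sum_neg_ln_one_minus (N : nat) :
  (1 <= N)%nat ->
  sum1 (fun j => - ln (1 - 4 / 5 * (INR j / INR N))) N
  <= INR N * (1 + ln (/ 5) / 4) + 4.
Proof.
  intros HN.
  pose proof (riemann_sum_le (fun s => - ln (1 - 4 / 5 * s))
    (fun s => 5 / 4 * ((1 - 4 / 5 * s) * ln (1 - 4 / 5 * s) - (1 - 4 / 5 * s))) 4 N HN) as H.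
  cbv beta in H.
  replace (INR N * (1 + ln (/ 5) / 4) + 4) with
    (INR N * (5 / 4 * ((1 - 4 / 5 * 1) * ln (1 - 4 / 5 * 1) - (1 - 4 / 5 * 1)) -
         5 / 4 * ((1 - 4 / 5 * 0) * ln (1 - 4 / 5 * 0) - (1 - 4 / 5 * 0))) + 4).
  2:{ replace (1 - 4 / 5 * 1) with (/ 5) by field.
      replace (1 - 4 / 5 * 0) with 1 by field. rewrite ln_1; field. }
  apply H; [lra| |].
  - intros s Hs. auto_derive; [lra|]. change (1 + - (4 / 5 * s)) with (1 - 4 / 5 * s). field; lra.
  - intros s t Hs Ht.
    apply increment_le with (f := fun s => - ln (1 - 4 / 5 * s))
      (df := fun s => 4 / 5 / (1 - 4 / 5 * s)); [lra| |].
    + intros x Hx. auto_derive; [lra|]. change (1 + - (4 / 5 * x)) with (1 - 4 / 5 * x). field; lra.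
    + intros x Hx. apply Rdiv_le_of_le_mul; lra.
Qed.

Lemma sum_ratio (N : nat) : (1 <= N)%nat ->
  sum1 (fun j => INR j / INR N) N = (INR N + 1) / 2.
Proof.
  intros HN. assert (Np : 0 < INR N) by (apply lt_0_INR; lia).
  assert (E : sum1 INR N = INR N * (INR N + 1) / 2).
  { clear. induction N as [|N IH]; [simpl; field|].
    cbn [sum1]. rewrite IH, S_INR. field. }
  rewrite (sum1_ext _ (fun j => / INR N * INR j)) by (intros; unfold Rdiv; ring).
  rewrite sum1_scal, E. field; lra.
Qed.

(** Both sides are symmetric about pi/2, and on [0, pi/2] the bound u - u^3/6 is enough because pi u
    <= 6 there. *)
Lemma sin_ge_parabola (u : R) : 0 <= u <= PI -> u * (1 - u / PI) <= sin u.
Proof.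
  pose proof PI_bounds as HP.
  assert (H : forall v, 0 <= v <= PI / 2 -> v * (1 - v / PI) <= sin v).
  { intros v Hv. apply Rle_trans with (2 := sin_ge_cubic v ltac:(lra)).
    replace (v - v ^ 3 / 6) with (v * (1 - v ^ 2 / 6)) by field.
    apply Rmult_le_compat_l; [lra|].
    assert (v * v / 6 <= v / PI); [|simpl; lra].
    apply Rmult_le_reg_r with PI; [lra|].
    replace (v / PI * PI) with v by (field; lra).
    assert (PI * v <= 6) by nra.
    nra. }
  intros Hu. destruct (Rle_dec u (PI / 2)) as [L|L]; [apply H; lra|].
  replace (u * (1 - u / PI)) with ((PI - u) * (1 - (PI - u) / PI)) by (field; lra).
  rewrite <- (sin_PI_x u). apply H; lra.
Qed.

(** One alternative for each of the three estimates. The last one asks for the growth bound at every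
    [K], because the cut-off is chosen later, from the bounding box alone. *)
Definition admissible (x y : R) : Prop :=
  (x = 2 * PI /\ 0 <= y <= 8 * PI / 5) \/
  (y = 8 * PI / 5 /\ - (2 / 10) <= x <= 2 * PI) \/
  (-100 <= x <= - (2 / 10) /\ Rabs y <= 100 /\
   forall K, (1 <= K)%nat -> growth x y K <= 495 / 10000).

(** With q = e^(z/N): the first clause bounds |q - 1|^2 from below for the power m + 1, the second
    makes the logarithms meaningful, the third is the exponential rate. *)
Definition product_bound (c D x y : R) (N : nat) : Prop :=
  c / (INR N * INR N) <= dist1 (exp (x / INR N)) (y / INR N) /\
  (forall j, (1 <= j <= N)%nat ->
     0 < dist1 (exp (x * (INR j / INR N))) (y * (INR j / INR N))) /\
  - sum1 (fun j => ln (dist1 (exp (x * (INR j / INR N))) (y * (INR j / INR N))) / 2) N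
  <= 5 / 100 * INR N + D.

Lemma neg_sum1 (f : nat -> R) (n : nat) : - sum1 f n = sum1 (fun k => - f k) n.
Proof.
  transitivity (-1 * sum1 f n); [ring|]. rewrite <- sum1_scal.
  apply sum1_ext; intros; ring.
Qed.

Lemma ratio_bounds (j N : nat) : (1 <= j <= N)%nat -> 0 < INR j / INR N <= 1.
Proof.
  intros Hj. assert (0 < INR j) by (apply lt_0_INR; lia).
  assert (INR j <= INR N) by (apply le_INR; lia).
  split; [apply Rdiv_lt_0_compat; lra|apply Rdiv_le_of_le_mul; lra].
Qed.

(** With t = j/N, |1 - q^j| >= e^(2 pi t) - 1 >= 2 pi t. As ln(2 pi) >= 1, the gain N ln(2 pi)
    cancels the N from the sum of -ln t. *)
Lemma product_bound_right (y : R) (N : nat) :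
  (1 <= N)%nat -> product_bound 1 0 (2 * PI) y N.
Proof.
  intros HN. pose proof PI_bounds as HP.
  assert (Np : 0 < INR N) by (apply lt_0_INR; lia).
  assert (H : forall t, 0 < t -> (2 * PI * t) * (2 * PI * t) <= dist1 (exp (2 * PI * t)) (y * t)).
  { intros t Ht. apply Rle_trans with (2 := dist1_ge _ _ (Rlt_le _ _ (exp_pos _))).
    pose proof (exp_ineq1_le (2 * PI * t)). assert (0 < 2 * PI * t) by nra.
    replace ((1 - exp (2 * PI * t)) * (1 - exp (2 * PI * t))) with
      ((exp (2 * PI * t) - 1) * (exp (2 * PI * t) - 1)) by ring.
    apply Rmult_le_compat; lra. }
  repeat split.
  - assert (0 < / INR N) by (apply Rinv_0_lt_compat; lra).
    apply Rle_trans with (2 := H (/ INR N) H0).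
    unfold Rdiv. rewrite Rinv_mult, Rmult_1_l. apply Rmult_le_compat; nra.
  - intros j Hj. pose proof (ratio_bounds j N Hj).
    eapply Rlt_le_trans; [|apply H; lra]. apply Rmult_lt_0_compat; nra.
  - rewrite neg_sum1.
    apply Rle_trans with (sum1 (fun j => - ln (2 * PI) + - ln (INR j / INR N)) N).
    + apply sum1_le; intros j Hj. pose proof (ratio_bounds j N Hj).
      apply Rle_trans with (- ln (2 * PI * (INR j / INR N))).
      * apply neg_ln_half_le; [nra|apply H; lra].
      * rewrite ln_mult by lra. lra.
    + rewrite sum1_plus, sum1_const. pose proof (sum_neg_ln_ratio N HN).
      assert (1 <= ln (2 * PI)).
      { rewrite <- (ln_exp 1). apply Rcomplements.ln_le; [apply exp_pos|].
        pose proof exp_le_3. lra. }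
      nra.
Qed.

Lemma product_bound_top (x : R) (N : nat) :
  (1 <= N)%nat -> - (2 / 10) <= x -> product_bound (1 / 2) 5 x (8 * PI / 5) N.
Proof.
  intros HN Hx. pose proof PI_bounds as HP.
  assert (Np : 0 < INR N) by (apply lt_0_INR; lia).
  (* Half of [w t] is the parabola below sin(yt/2) at y = 8 pi/5; [w t >= t] holds because 8 pi/25 >
     1. *)
  set (w := fun t => 8 * PI / 5 * (t * (1 - 4 / 5 * t))).
  assert (W : forall t, 0 < t <= 1 -> t <= w t).
  { intros t Ht. unfold w. assert (1 / 5 <= 1 - 4 / 5 * t) by lra.
    assert (t * (1 / 5) <= t * (1 - 4 / 5 * t)) by (apply Rmult_le_compat_l; lra).
    nra. }
  assert (H : forall t, 0 < t <= 1 ->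
     exp (x * t) * (w t * w t) <= dist1 (exp (x * t)) (8 * PI / 5 * t)).
  { intros t Ht. rewrite dist1_sin.
    pose proof (exp_pos (x * t)) as E. set (r := exp (x * t)) in *.
    pose proof (sin_ge_parabola (8 * PI / 5 * t / 2) ltac:(split; nra)) as S.
    replace (8 * PI / 5 * t / 2 * (1 - 8 * PI / 5 * t / 2 / PI)) with (w t / 2) in S
      by (unfold w; field; lra).
    specialize (W t Ht).
    assert (w t / 2 * (w t / 2) <= sin (8 * PI / 5 * t / 2) ^ 2) by nra.
    assert (0 <= (r - 1) ^ 2) by apply pow2_ge_0.
    nra. }
  repeat split.
  - assert (Ni : 0 < / INR N <= 1).
    { replace (/ INR N) with (INR 1 / INR N) by (simpl; field; lra). apply ratio_bounds; lia. }
    apply Rle_trans with (2 := H (/ INR N) Ni).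
    unfold Rdiv at 1. rewrite Rinv_mult. specialize (W _ Ni).
    assert (1 / 2 <= exp (x * / INR N)).
    { pose proof (exp_ineq1_le (x * / INR N)). nra. }
    assert (/ INR N * / INR N <= w (/ INR N) * w (/ INR N)) by nra.
    unfold Rdiv in *. nra.
  - intros j Hj. pose proof (ratio_bounds j N Hj) as B.
    eapply Rlt_le_trans; [|apply H; lra]. specialize (W _ B).
    apply Rmult_lt_0_compat; [apply exp_pos|nra].
  - rewrite neg_sum1.
    apply Rle_trans with (sum1 (fun j => 1 / 10 * (INR j / INR N)
      + (- ln (8 * PI / 5) + (- ln (INR j / INR N) + - ln (1 - 4 / 5 * (INR j / INR N))))) N).
    + apply sum1_le; intros j Hj. pose proof (ratio_bounds j N Hj) as B.
      set (t := INR j / INR N) in *. specialize (H t B). specialize (W t B).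
      apply Rle_trans with (- ln (exp (x * t / 2) * w t)).
      * apply neg_ln_half_le.
        -- apply Rmult_lt_0_compat; [apply exp_pos|lra].
        -- replace (exp (x * t / 2) * w t * (exp (x * t / 2) * w t)) with
             (exp (x * t / 2) * exp (x * t / 2) * (w t * w t)) by ring.
           rewrite <- exp_plus. replace (x * t / 2 + x * t / 2) with (x * t) by field. auto.
      * rewrite ln_mult, ln_exp by (try apply exp_pos; lra).
        unfold w. rewrite ln_mult, ln_mult by nra. nra.
    + rewrite sum1_plus, sum1_scal, sum_ratio, sum1_plus, sum1_const, sum1_plus by auto.
      pose proof (sum_neg_ln_ratio N HN). pose proof (sum_neg_ln_one_minus N HN).
      (* With ln(8 pi/5) >= ln 5 >= 8/5 the coefficients of N add up to at most -8/5 + 1 + 1 - 2/5 =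
         0, so the whole 0.05 N comes from the sum of t/10, that is, from x >= -1/5. *)
      assert (L5 : ln (/ 5) <= - (16 / 10)).
      { rewrite <- (ln_exp (- (16 / 10))). apply Rcomplements.ln_le; [lra|].
        apply exp_neg_ge_of_power with (v := 4 / 10) (n := 4%nat); [lra|simpl; lra|lra]. }
      assert (ln 5 <= ln (8 * PI / 5)) by (apply Rcomplements.ln_le; lra).
      rewrite ln_Rinv in * by lra.
      nra.
Qed.

Lemma product_bound_left :
  exists c D, 0 < c /\ forall x y N, (1 <= N)%nat ->
  -100 <= x <= - (2 / 10) -> Rabs y <= 100 ->
  (forall K, (1 <= K)%nat -> growth x y K <= 495 / 10000) -> product_bound c D x y N.
Proof.
  (* The tolerance 0.0005 is the gap between 0.0495 and 0.05. *)
  destruct (neg_ln_product_le (2 / 10) 100 (5 / 10000)) as (K & C & HK & H); try lra.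
  (* In -xt/(1 - xt) the numerator is at least t/5 and the denominator at most 101. *)
  exists ((2 / 1010) * (2 / 1010)), C. split; [lra|].
  intros x y N HN Hx Hy Hg.
  assert (Np : 0 < INR N) by (apply lt_0_INR; lia).
  assert (B : forall t, 0 < t <= 1 -> 2 / 1010 * t <= 1 - exp (x * t)).
  { intros t Ht. pose proof (one_minus_exp_neg_ge (- x * t) ltac:(nra)) as E.
    replace (- (- x * t)) with (x * t) in E by ring.
    apply Rle_trans with (2 := E).
    apply Rmult_le_reg_r with (1 + - x * t); [nra|].
    replace (- x * t / (1 + - x * t) * (1 + - x * t)) with (- x * t) by (field; nra). nra. }
  assert (P : forall t, 0 < t <= 1 ->
     2 / 1010 * t * (2 / 1010 * t) <= dist1 (exp (x * t)) (y * t)).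
  { intros t Ht. apply Rle_trans with (2 := dist1_ge _ _ (Rlt_le _ _ (exp_pos _))).
    specialize (B t Ht). apply Rmult_le_compat; lra. }
  repeat split.
  - assert (Ni : 0 < / INR N <= 1).
    { replace (/ INR N) with (INR 1 / INR N) by (simpl; field; lra). apply ratio_bounds; lia. }
    apply Rle_trans with (2 := P (/ INR N) Ni). right; field; lra.
  - intros j Hj. pose proof (ratio_bounds j N Hj) as R.
    eapply Rlt_le_trans; [|apply P; lra]. apply Rmult_lt_0_compat; lra.
  - specialize (H N x y HN ltac:(lra) Hy). specialize (Hg K HK).
    assert (INR N * (growth x y K + 5 / 10000) <= INR N * (5 / 100))
      by (apply Rmult_le_compat_l; lra). lra.
Qed.

Lemma admissible_product_bound :
  exists c D, 0 < c /\ forall x y N, (1 <= N)%nat -> admissible x y -> product_bound c D x y N.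
Proof.
  destruct product_bound_left as (c & D & Hc & H).
  exists (Rmin c (1 / 2)), (Rmax D 5).
  pose proof (Rmin_l c (1 / 2)). pose proof (Rmin_r c (1 / 2)).
  pose proof (Rmax_l D 5). pose proof (Rmax_r D 5).
  split; [apply Rmin_glb_lt; lra|].
  intros x y N HN Ha.
  assert (Q : forall c' D', Rmin c (1 / 2) <= c' -> D' <= Rmax D 5 -> product_bound c' D' x y N ->
     product_bound (Rmin c (1 / 2)) (Rmax D 5) x y N).
  { intros c' D' Hc' HD' (A1 & A2 & A3). repeat split; auto; [|lra].
    apply Rle_trans with (2 := A1).
    assert (Np : 0 < INR N) by (apply lt_0_INR; lia).
    apply Rmult_le_compat_r; [left; apply Rinv_0_lt_compat; nra|auto]. }
  destruct Ha as [[-> Hy]|[[-> Hx]|(Hx & Hy & Hg)]].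
  - apply (Q 1 0); [lra|lra|]. apply product_bound_right; auto.
  - apply (Q (1 / 2) 5); [lra|lra|]. apply product_bound_top; auto; lra.
  - apply (Q c D); auto.
Qed.

(** * The integrals *)

Lemma Cnorm2_mul (z w : Cx) : Cnorm2 (Cmul z w) = Cnorm2 z * Cnorm2 w.
Proof. unfold Cnorm2, Cmul; simpl; ring. Qed.

Lemma Cnorm2_nonneg (z : Cx) : 0 <= Cnorm2 z.
Proof. unfold Cnorm2; nra. Qed.

Lemma Cnorm2_inv (z : Cx) : Cnorm2 z <> 0 -> Cnorm2 (Cinv z) = / Cnorm2 z.
Proof. intros H. unfold Cinv. unfold Cnorm2 in *; simpl. field. auto. Qed.

Lemma Cnorm2_pow (z : Cx) (n : nat) : Cnorm2 (Cpow z n) = Cnorm2 z ^ n.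
Proof.
  induction n as [|n IH]; simpl; [unfold Cnorm2; simpl; ring|].
  rewrite Cnorm2_mul, IH; auto.
Qed.

Lemma Cnorm2_zpow (z : Cx) (k : Z) :
  Cnorm2 z <> 0 -> Cnorm2 (Czpow z k) = powerRZ (Cnorm2 z) k.
Proof.
  intros H. destruct k; simpl.
  - unfold Cnorm2; simpl; ring.
  - apply Cnorm2_pow.
  - rewrite Cnorm2_inv; rewrite Cnorm2_pow; auto. apply pow_nonzero; auto.
Qed.

Lemma Cexp_pow (u v : R) (n : nat) :
  Cpow (Cexp (mkC u v)) n = Cexp (mkC (INR n * u) (INR n * v)).
Proof.
  induction n as [|n IH].
  - unfold Cexp; simpl. rewrite !Rmult_0_l, exp_0, cos_0, sin_0, Rmult_1_r, Rmult_0_r. reflexivity.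
  - simpl Cpow. rewrite IH, S_INR. unfold Cexp, Cmul; simpl.
    rewrite !Rmult_plus_distr_r, !Rmult_1_l, exp_plus, cos_plus, sin_plus. f_equal; ring.
Qed.

Lemma Cnorm2_Cexp (z : Cx) : Cnorm2 (Cexp z) = exp (2 * Re z).
Proof.
  unfold Cnorm2, Cexp; simpl.
  replace (2 * Re z) with (Re z + Re z) by ring. rewrite exp_plus.
  pose proof (sin2_cos2 (Im z)) as E. unfold Rsqr in E.
  transitivity (exp (Re z) * exp (Re z) * (sin (Im z) * sin (Im z) + cos (Im z) * cos (Im z)));
    [ring|rewrite E; ring].
Qed.

Lemma Cnorm2_one_sub_Cexp (u v : R) : Cnorm2 (Csub C1 (Cexp (mkC u v))) = dist1 (exp u) v.
Proof.
  unfold Cnorm2, Csub, Cadd, Copp, C1, Cexp, dist1; simpl.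
  pose proof (sin2_cos2 v) as E. unfold Rsqr in E.
  transitivity (1 - 2 * exp u * cos v
    + exp u * exp u * (sin v * sin v + cos v * cos v)); [ring|rewrite E; ring].
Qed.

Lemma Cnorm2_Cexp_sub_one (u v : R) : Cnorm2 (Csub (Cexp (mkC u v)) C1) = dist1 (exp u) v.
Proof.
  rewrite <- Cnorm2_one_sub_Cexp.
  unfold Cnorm2, Csub, Cadd, Copp; simpl; ring.
Qed.

Lemma Cmul_RtoC (z : Cx) (r : R) : Cmul z (RtoC r) = mkC (Re z * r) (Im z * r).
Proof. unfold Cmul, RtoC; simpl; f_equal; ring. Qed.

Lemma Cnorm2_qpoch (x y : R) (N n : nat) :
  (1 <= N)%nat -> (n <= N)%nat ->
  (forall j, (1 <= j <= N)%nat ->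
     0 < dist1 (exp (x * (INR j / INR N))) (y * (INR j / INR N))) ->
  Cnorm2 (qpoch (Cexp (mkC (x * / INR N) (y * / INR N))) n) =
  exp (2 * sum1 (fun j => ln (dist1 (exp (x * (INR j / INR N))) (y * (INR j / INR N))) / 2) n).
Proof.
  intros HN. induction n as [|n IH]; intros Hn H.
  - simpl. rewrite Rmult_0_r, exp_0. unfold Cnorm2; simpl; ring.
  - simpl qpoch. cbn [sum1]. rewrite Cnorm2_mul, IH, Rmult_plus_distr_l, exp_plus by (auto; lia).
    f_equal.
    change (Cmul ?a (Cpow ?a n)) with (Cpow a (S n)).
    rewrite Cexp_pow, Cnorm2_one_sub_Cexp.
    replace (INR (S n) * (x * / INR N)) with (x * (INR (S n) / INR N)) by (unfold Rdiv; ring).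
    replace (INR (S n) * (y * / INR N)) with (y * (INR (S n) / INR N)) by (unfold Rdiv; ring).
    match goal with |- _ = exp (2 * (ln ?d / 2)) =>
      replace (2 * (ln d / 2)) with (ln d) by field end.
    rewrite exp_ln; auto. apply H; lia.
Qed.

(** The power is monotone in [p], in a direction given by the sign of [k]; adding both end values
    covers either sign. *)
Lemma powerRZ_between (p lo hi : R) (k : Z) :
  0 < lo -> lo <= p <= hi -> powerRZ p k <= powerRZ lo k + powerRZ hi k.
Proof.
  intros Hlo Hp.
  assert (0 < powerRZ lo k) by (apply powerRZ_lt; lra).
  assert (0 < powerRZ hi k) by (apply powerRZ_lt; lra).
  destruct k as [|k|k]; simpl in *; [lra| |].
  - assert (p ^ Pos.to_nat k <= hi ^ Pos.to_nat k) by (apply pow_incr; lra). lra.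
  - assert (lo ^ Pos.to_nat k <= p ^ Pos.to_nat k) by (apply pow_incr; lra).
    assert (/ p ^ Pos.to_nat k <= / lo ^ Pos.to_nat k)
      by (apply Rinv_le_contravar; [apply pow_lt; lra|auto]). lra.
Qed.

(** The upper bound for |q - 1|, required when m + 1 is negative. *)
Lemma dist1_exp_le (B a b : R) :
  0 <= B -> Rabs a <= B -> dist1 (exp a) b <= exp (2 * B) * (a * a + b * b).
Proof.
  intros HB Ha. rewrite dist1_sin.
  assert (Ha' : - B <= a <= B) by (unfold Rabs in Ha; destruct (Rcase_abs a); lra).
  assert (E1 : exp a <= exp B) by (apply exp_le_exp; lra).
  assert (E2 : 1 <= exp B) by (rewrite <- exp_0; apply exp_le_exp; lra).
  assert (E3 : exp (2 * B) = exp B * exp B) by (rewrite <- exp_plus; f_equal; ring).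
  pose proof (exp_pos a) as Ep.
  assert (S : sin (b / 2) ^ 2 <= (b / 2) ^ 2).
  { rewrite <- (pow2_abs (sin _)), <- (pow2_abs (b / 2)). apply pow_incr.
    split; [apply Rabs_pos|].
    assert (P : forall u, 0 <= u -> sin u <= u).
    { intros u [Hu|<-]; [left; apply sin_lt_x; auto|rewrite sin_0; lra]. }
    assert (P' : forall u, 0 <= u -> - u <= sin u).
    { intros u Hu.
      assert (0 + sin 0 <= u + sin u); [|rewrite sin_0 in *; lra].
      apply deriv_nonneg_le with (f := fun u => u + sin u) (df := fun u => 1 + cos u); auto.
      - intros x Hx; auto_derive; auto; ring.
      - intros x Hx; pose proof (COS_bound x); lra. }
    set (u := b / 2). apply Rabs_le.
    unfold Rabs; destruct (Rcase_abs u) as [C|C].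
    - pose proof (P (- u) ltac:(lra)). pose proof (P' (- u) ltac:(lra)).
      rewrite sin_neg in *. lra.
    - pose proof (P u ltac:(lra)). pose proof (P' u ltac:(lra)). lra. }
  assert (Q : (exp a - 1) ^ 2 <= exp B * exp B * (a * a)).
  { assert (U : exp a - 1 <= a * exp a).
    { pose proof (exp_ineq1_le (- a)) as V. rewrite exp_Ropp in V.
      apply Rmult_le_compat_r with (r := exp a) in V; [|lra]. rewrite Rinv_l in V; lra. }
    pose proof (exp_ineq1_le a) as V.
    replace (exp B * exp B * (a * a)) with ((exp B * a) ^ 2) by ring.
    rewrite <- (pow2_abs (exp a - 1)), <- (pow2_abs (exp B * a)). apply pow_incr.
    split; [apply Rabs_pos|]. rewrite Rabs_mult, (Rabs_right (exp B)) by lra.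
    unfold Rabs; destruct (Rcase_abs (exp a - 1)); destruct (Rcase_abs a); nra. }
  assert (4 * exp a * sin (b / 2) ^ 2 <= exp B * exp B * (b * b)).
  { apply Rle_trans with (4 * exp a * (b / 2) ^ 2); [apply Rmult_le_compat_l; lra|].
    replace (4 * exp a * (b / 2) ^ 2) with (exp a * (b * b)) by field.
    apply Rmult_le_compat_r; nra. }
  rewrite E3. lra.
Qed.

Lemma admissible_box (x y : R) : admissible x y -> Rabs x <= 100 /\ Rabs y <= 100.
Proof.
  pose proof PI_bounds. intros [[-> Hy]|[[-> Hx]|(Hx & Hy & _)]]; split; auto; apply Rabs_le; lra.
Qed.

(** Squared norms avoid square roots, so all exponents double: |q - 1|^2 N^2 lies between two
    positive constants, hence |q - 1|^(-2(m+1)) is at most a constant times N^(2(m+1)). The two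
    nonvanishing claims serve the continuity of the integrand. *)
Lemma integrand_bound (m : Z) :
  exists K, 0 < K /\ forall N z, (1 <= N)%nat -> admissible (Re z) (Im z) ->
  let q := Cexp (Cmul z (RtoC (/ INR N))) in
  Cnorm2 (Csub q C1) <> 0 /\ Cnorm2 (qpoch q N) <> 0 /\
  Cnorm2 (integrand m N z) <=
  (K * powerRZ (INR N) (m + 1) * exp (5 / 100 * INR N)) ^ 2.
Proof.
  destruct admissible_product_bound as (c & D & Hc & HPB).
  set (hi := exp (2 * 100) * (2 * 100 * 100)).
  set (k := (m + 1)%Z).
  set (K0 := powerRZ c (- k) + powerRZ (c + hi) (- k)).
  assert (Hhi : 0 < hi) by (unfold hi; pose proof (exp_pos (2 * 100)); nra).
  assert (HK0 : 0 < K0).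
  { unfold K0. apply Rplus_lt_0_compat; apply powerRZ_lt; lra. }
  set (K1 := exp 200 * K0 * exp (2 * D)).
  assert (HK1 : 0 < K1) by (unfold K1; repeat apply Rmult_lt_0_compat; auto; apply exp_pos).
  (* The square of [1 + K1] exceeds [K1], so no square root of [K1] has to be taken. *)
  exists (1 + K1). split; [lra|].
  intros N [x y] HN Ha q. simpl in Ha.
  assert (Np : 0 < INR N) by (apply lt_0_INR; lia).
  destruct (admissible_box x y Ha) as [Hx Hy].
  destruct (HPB x y N HN Ha) as (B1 & B2 & B3).
  assert (Eq : q = Cexp (mkC (x * / INR N) (y * / INR N))).
  { unfold q. rewrite Cmul_RtoC. reflexivity. }
  assert (E1 : Cnorm2 (Csub q C1) = dist1 (exp (x / INR N)) (y / INR N)).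
  { rewrite Eq. apply Cnorm2_Cexp_sub_one. }
  pose proof (Cnorm2_qpoch x y N N HN (le_n N) B2) as E2. rewrite <- Eq in E2.
  set (S := sum1 _ N) in *.
  set (d := Cnorm2 (Csub q C1)) in *.
  assert (Ni : 0 < / INR N) by (apply Rinv_0_lt_compat; lra).
  assert (Ni1 : / INR N <= 1).
  { rewrite <- Rinv_1. apply Rinv_le_contravar; [lra|].
    change 1 with (INR 1). apply le_INR; auto. }
  assert (dp : 0 < d).
  { rewrite E1. apply Rlt_le_trans with (2 := B1). apply Rdiv_lt_0_compat; nra. }
  assert (Pp : 0 < Cnorm2 (qpoch q N)) by (rewrite E2; apply exp_pos).
  split; [lra|split; [lra|]].
  set (p := d * (INR N * INR N)).
  assert (Hp : c <= p <= c + hi).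
  { split.
    - unfold p. rewrite E1. apply Rmult_le_reg_r with (/ (INR N * INR N));
        [apply Rinv_0_lt_compat; nra|].
      rewrite Rmult_assoc, Rinv_r by nra. unfold Rdiv in B1. lra.
    - assert (A : Rabs (x / INR N) <= 100).
      { unfold Rdiv. rewrite Rabs_mult, (Rabs_right (/ INR N)) by lra.
        pose proof (Rabs_pos x). nra. }
      pose proof (dist1_exp_le 100 (x / INR N) (y / INR N) ltac:(lra) A) as U.
      rewrite <- E1 in U.
      apply Rmult_le_compat_r with (r := INR N * INR N) in U; [|nra]. fold p in U.
      replace (exp (2 * 100) * (x / INR N * (x / INR N) + y / INR N * (y / INR N))
               * (INR N * INR N)) with (exp (2 * 100) * (x * x + y * y)) in U by (field; lra).
      assert (x * x + y * y <= 2 * 100 * 100).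
      { apply Rabs_le_between in Hx, Hy. nra. }
      assert (exp (2 * 100) * (x * x + y * y) <= hi)
        by (apply Rmult_le_compat_l; [left; apply exp_pos|auto]).
      lra. }
  set (v := powerRZ (INR N) k).
  assert (Hv : 0 < v) by (apply powerRZ_lt; auto).
  assert (Hd : / powerRZ d k <= K0 * (v * v)).
  { replace d with (p * (/ INR N * / INR N)) by (unfold p; field; lra).
    rewrite !powerRZ_mult, !powerRZ_inv', !Rinv_mult, !Rinv_inv, <- powerRZ_neg'.
    apply Rmult_le_compat_r; [nra|]. apply powerRZ_between; auto. }
  assert (Hq : Cnorm2 q <= exp 200).
  { rewrite Eq, Cnorm2_Cexp. apply exp_le_exp. simpl.
    apply Rabs_le_between in Hx.
    assert (x * / INR N <= 100 * / INR N) by (apply Rmult_le_compat_r; lra). lra. }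
  assert (HS : / exp (2 * S) <= exp (2 * D) * (exp (5 / 100 * INR N)) ^ 2).
  { rewrite <- exp_Ropp. simpl. rewrite Rmult_1_r, <- !exp_plus. apply exp_le_exp. lra. }
  assert (H2pi : Cnorm2 (Cmul (RtoC (2 * PI)) Ci) = 4 * (PI * PI)).
  { unfold Cnorm2; simpl; ring. }
  pose proof PI_bounds as HP.
  assert (Hz : Cnorm2 (Czpow (Csub q C1) k) = powerRZ d k) by (apply Cnorm2_zpow; fold d; lra).
  assert (Hdk : 0 < powerRZ d k) by (apply powerRZ_lt; auto).
  assert (Hden : Cnorm2 (Cmul (Cmul (Cmul (RtoC (2 * PI)) Ci) (Czpow (Csub q C1) k)) (qpoch q N))
    = 4 * (PI * PI) * powerRZ d k * exp (2 * S)).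
  { rewrite (Cnorm2_mul _ (qpoch q N)), (Cnorm2_mul _ (Czpow _ _)), H2pi, Hz, E2. ring. }
  unfold integrand. fold q. fold k. unfold Cdiv.
  pose proof (exp_pos (2 * S)) as HSp.
  rewrite Cnorm2_mul, Cnorm2_inv, Hden.
  2:{ rewrite Hden. apply Rgt_not_eq. apply Rmult_lt_0_compat; auto.
      apply Rmult_lt_0_compat; auto. nra. }
  rewrite !Rinv_mult.
  set (e := exp (5 / 100 * INR N)) in *. assert (He : 0 < e) by apply exp_pos.
  apply Rle_trans with (exp 200 * (1 * (K0 * (v * v)) * (exp (2 * D) * e ^ 2))).
  - pose proof (Cnorm2_nonneg q).
    assert (0 < / exp (2 * S)) by (apply Rinv_0_lt_compat; auto).
    assert (0 < / powerRZ d k) by (apply Rinv_0_lt_compat; auto).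
    assert (P1 : 0 < / 4 * (/ PI * / PI) <= 1).
    { split; [repeat apply Rmult_lt_0_compat; try apply Rinv_0_lt_compat; lra|].
      rewrite <- !Rinv_mult, <- Rinv_1. apply Rinv_le_contravar; nra. }
    apply Rmult_le_compat; [auto| |auto|].
    + apply Rmult_le_pos; [apply Rmult_le_pos|]; lra.
    + apply Rmult_le_compat; [apply Rmult_le_pos; lra|lra| |auto].
      apply Rmult_le_compat; lra.
  - replace (exp 200 * (1 * (K0 * (v * v)) * (exp (2 * D) * e ^ 2))) with
      (K1 * (v * v * (e * e))) by (unfold K1; ring).
    replace (((1 + K1) * v * e) ^ 2) with ((1 + K1) ^ 2 * (v * v * (e * e))) by ring.
    assert (0 < v * v) by nra. assert (0 < e * e) by nra.
    apply Rmult_le_compat_r; [apply Rmult_le_pos; lra|nra].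
Qed.

(** * Continuity of the integrand along a path *)

Definition Ccontinuous (f : R -> Cx) (t : R) : Prop :=
  continuity_pt (fun s => Re (f s)) t /\ continuity_pt (fun s => Im (f s)) t.

Lemma Ccontinuous_const (z : Cx) (t : R) : Ccontinuous (fun _ => z) t.
Proof. split; apply continuity_pt_const; intros ? ?; reflexivity. Qed.

Lemma Ccontinuous_RtoC (t : R) : Ccontinuous (fun s => RtoC s) t.
Proof.
  split; simpl; [apply derivable_continuous_pt, derivable_pt_id|].
  apply continuity_pt_const; intros ? ?; reflexivity.
Qed.

Lemma Ccontinuous_add (f g : R -> Cx) (t : R) :
  Ccontinuous f t -> Ccontinuous g t -> Ccontinuous (fun s => Cadd (f s) (g s)) t.
Proof.
  intros [F1 F2] [G1 G2]; split; simpl.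
  - exact (continuity_pt_plus _ _ t F1 G1).
  - exact (continuity_pt_plus _ _ t F2 G2).
Qed.

Lemma Ccontinuous_opp (f : R -> Cx) (t : R) :
  Ccontinuous f t -> Ccontinuous (fun s => Copp (f s)) t.
Proof.
  intros [F1 F2]; split; simpl.
  - exact (continuity_pt_opp _ t F1).
  - exact (continuity_pt_opp _ t F2).
Qed.

Lemma Ccontinuous_mul (f g : R -> Cx) (t : R) :
  Ccontinuous f t -> Ccontinuous g t -> Ccontinuous (fun s => Cmul (f s) (g s)) t.
Proof.
  intros [F1 F2] [G1 G2]; split; simpl.
  - exact (continuity_pt_minus _ _ t (continuity_pt_mult _ _ t F1 G1)
             (continuity_pt_mult _ _ t F2 G2)).
  - exact (continuity_pt_plus _ _ t (continuity_pt_mult _ _ t F1 G2)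
             (continuity_pt_mult _ _ t F2 G1)).
Qed.

Lemma Ccontinuous_inv (f : R -> Cx) (t : R) :
  Cnorm2 (f t) <> 0 -> Ccontinuous f t -> Ccontinuous (fun s => Cinv (f s)) t.
Proof.
  intros H [F1 F2].
  assert (N : continuity_pt (fun s => Cnorm2 (f s)) t).
  { exact (continuity_pt_plus _ _ t (continuity_pt_mult _ _ t F1 F1)
             (continuity_pt_mult _ _ t F2 F2)). }
  split; simpl.
  - exact (continuity_pt_div _ _ t F1 N H).
  - exact (continuity_pt_div _ _ t (continuity_pt_opp _ t F2) N H).
Qed.

Lemma Ccontinuous_exp (f : R -> Cx) (t : R) :
  Ccontinuous f t -> Ccontinuous (fun s => Cexp (f s)) t.
Proof.
  intros [F1 F2].
  assert (E : continuity_pt (fun s => exp (Re (f s))) t).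
  { apply (continuity_pt_comp _ exp t F1). apply derivable_continuous_pt, derivable_pt_exp. }
  split; simpl; apply (continuity_pt_mult (fun s => exp (Re (f s))) _ t E).
  - apply (continuity_pt_comp _ cos t F2). apply continuity_cos.
  - apply (continuity_pt_comp _ sin t F2). apply continuity_sin.
Qed.

Lemma Ccontinuous_pow (f : R -> Cx) (n : nat) (t : R) :
  Ccontinuous f t -> Ccontinuous (fun s => Cpow (f s) n) t.
Proof.
  intros F. induction n as [|n IH]; simpl; [apply Ccontinuous_const|].
  apply Ccontinuous_mul; auto.
Qed.

Lemma Ccontinuous_zpow (f : R -> Cx) (k : Z) (t : R) :
  Cnorm2 (f t) <> 0 -> Ccontinuous f t -> Ccontinuous (fun s => Czpow (f s) k) t.
Proof.
  intros H F. destruct k; simpl; [apply Ccontinuous_const|apply Ccontinuous_pow; auto|].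
  apply Ccontinuous_inv; [|apply Ccontinuous_pow; auto].
  rewrite Cnorm2_pow. apply pow_nonzero; auto.
Qed.

Lemma Ccontinuous_qpoch (f : R -> Cx) (n : nat) (t : R) :
  Ccontinuous f t -> Ccontinuous (fun s => qpoch (f s) n) t.
Proof.
  intros F. induction n as [|n IH]; cbn [qpoch]; [apply Ccontinuous_const|].
  apply Ccontinuous_mul; auto. apply Ccontinuous_add; [apply Ccontinuous_const|].
  apply Ccontinuous_opp, Ccontinuous_pow; auto.
Qed.

Lemma Ccontinuous_integrand (m : Z) (N : nat) (f : R -> Cx) (t : R) :
  let q := Cexp (Cmul (f t) (RtoC (/ INR N))) in
  Cnorm2 (Csub q C1) <> 0 -> Cnorm2 (qpoch q N) <> 0 ->
  Ccontinuous f t -> Ccontinuous (fun s => integrand m N (f s)) t.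
Proof.
  intros q H1 H2 F. pose proof PI_bounds as HP. unfold integrand, Cdiv.
  assert (Q : Ccontinuous (fun s => Cexp (Cmul (f s) (RtoC (/ INR N)))) t).
  { apply Ccontinuous_exp, Ccontinuous_mul; auto. apply Ccontinuous_const. }
  assert (Q1 : Ccontinuous (fun s => Csub (Cexp (Cmul (f s) (RtoC (/ INR N)))) C1) t).
  { apply Ccontinuous_add; auto. apply Ccontinuous_const. }
  apply Ccontinuous_mul; auto. apply Ccontinuous_inv.
  - fold q. rewrite (Cnorm2_mul _ (qpoch q N)), (Cnorm2_mul _ (Czpow _ _)), Cnorm2_zpow by auto.
    apply Rmult_integral_contrapositive_currified; auto.
    apply Rmult_integral_contrapositive_currified; [|apply powerRZ_NOR; auto].
    unfold Cnorm2; simpl; nra.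
  - apply Ccontinuous_mul; [|apply Ccontinuous_qpoch; auto].
    apply Ccontinuous_mul; [apply Ccontinuous_const|apply Ccontinuous_zpow; auto].
Qed.

(** * Existence and size of integrals over segments *)

Lemma RiemannInt_abs_le (f : R -> R) (M : R) (pr : Riemann_integrable f 0 1) :
  (forall t, 0 <= t <= 1 -> Rabs (f t) <= M) -> Rabs (RiemannInt pr) <= M.
Proof.
  intros H. apply Rabs_le.
  pose proof (RiemannInt_P15 (RiemannInt_P14 0 1 M)) as U.
  pose proof (RiemannInt_P15 (RiemannInt_P14 0 1 (- M))) as L.
  assert (RiemannInt pr <= RiemannInt (RiemannInt_P14 0 1 M)).
  { apply RiemannInt_P19; [lra|]. intros t Ht. specialize (H t ltac:(lra)).
    apply Rabs_le_between in H. unfold fct_cte; lra. }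
  assert (RiemannInt (RiemannInt_P14 0 1 (- M)) <= RiemannInt pr).
  { apply RiemannInt_P19; [lra|]. intros t Ht. specialize (H t ltac:(lra)).
    apply Rabs_le_between in H. unfold fct_cte; lra. }
  lra.
Qed.

Lemma Re_Im_le_of_Cnorm2 (z : Cx) (M : R) :
  0 <= M -> Cnorm2 z <= M ^ 2 -> Rabs (Re z) <= M /\ Rabs (Im z) <= M.
Proof.
  intros HM H. unfold Cnorm2 in H.
  split; apply Rabs_le; split; nra.
Qed.

(** Real and imaginary parts are bounded separately, which replaces the triangle inequality for
    complex-valued integrals and costs a factor 2 in the final constant. *)
Lemma seg_integral_bound (f : Cx -> Cx) (a b : Cx) (M : R) :
  0 <= M ->
  (forall t, 0 <= t <= 1 ->
     Ccontinuous (fun s => f (Cadd a (Cmul (RtoC s) (Csub b a)))) t /\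
     Cnorm2 (f (Cadd a (Cmul (RtoC t) (Csub b a)))) <= M ^ 2) ->
  exists I, seg_integral f a b I /\
    Rabs (Re I) <= M * Cnorm (Csub b a) /\ Rabs (Im I) <= M * Cnorm (Csub b a).
Proof.
  intros HM H. unfold seg_integral.
  set (g := fun t : R => Cmul (f (Cadd a (Cmul (RtoC t) (Csub b a)))) (Csub b a)).
  assert (Hc : forall t, 0 <= t <= 1 -> Ccontinuous g t).
  { intros t Ht. apply Ccontinuous_mul; [apply H; auto|apply Ccontinuous_const]. }
  assert (Hl : 0 <= Cnorm (Csub b a)) by apply sqrt_pos.
  assert (Hb : forall t, 0 <= t <= 1 ->
    Rabs (Re (g t)) <= M * Cnorm (Csub b a) /\ Rabs (Im (g t)) <= M * Cnorm (Csub b a)).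
  { intros t Ht. apply Re_Im_le_of_Cnorm2; [apply Rmult_le_pos; auto|].
    unfold g. rewrite Cnorm2_mul, Rpow_mult_distr.
    replace (Cnorm (Csub b a) ^ 2) with (Cnorm2 (Csub b a)).
    - apply Rmult_le_compat_r; [apply Cnorm2_nonneg|apply H; auto].
    - unfold Cnorm. rewrite <- (sqrt_sqrt (Cnorm2 (Csub b a))) at 1 by apply Cnorm2_nonneg. ring. }
  assert (pr1 : Riemann_integrable (fun t => Re (g t)) 0 1).
  { apply continuity_implies_RiemannInt; [lra|]. intros t Ht; apply (Hc t Ht). }
  assert (pr2 : Riemann_integrable (fun t => Im (g t)) 0 1).
  { apply continuity_implies_RiemannInt; [lra|]. intros t Ht; apply (Hc t Ht). }
  exists (mkC (RiemannInt pr1) (RiemannInt pr2)). repeat split; simpl.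
  - exists pr1, pr2; auto.
  - apply RiemannInt_abs_le; intros t Ht; apply (Hb t Ht).
  - apply RiemannInt_abs_le; intros t Ht; apply (Hb t Ht).
Qed.

Lemma Cnorm_le_Rabs (z : Cx) (A B : R) :
  Rabs (Re z) <= A -> Rabs (Im z) <= B -> Cnorm z <= A + B.
Proof.
  intros HA HB. pose proof (Rabs_pos (Re z)). pose proof (Rabs_pos (Im z)).
  unfold Cnorm, Cnorm2. rewrite <- (sqrt_square (A + B)) by lra.
  apply sqrt_le_1_alt.
  pose proof (Rsqr_abs (Re z)) as E1. pose proof (Rsqr_abs (Im z)) as E2.
  unfold Rsqr in *. rewrite E1, E2. nra.
Qed.

Definition admissible_segment (a b : Cx) : Prop :=
  forall t, 0 <= t <= 1 ->
  admissible (Re a + t * (Re b - Re a)) (Im a + t * (Im b - Im a)).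

Lemma seg_integral_admissible (m : Z) :
  exists K, 0 < K /\ forall N a b, (1 <= N)%nat -> admissible_segment a b ->
  exists I, seg_integral (integrand m N) a b I /\
    Rabs (Re I) <=
      K * powerRZ (INR N) (m + 1) * exp (5 / 100 * INR N) * Cnorm (Csub b a) /\
    Rabs (Im I) <=
      K * powerRZ (INR N) (m + 1) * exp (5 / 100 * INR N) * Cnorm (Csub b a).
Proof.
  destruct (integrand_bound m) as (K & HK & H). exists K. split; auto.
  intros N a b HN Hab. apply seg_integral_bound.
  - assert (0 < INR N) by (apply lt_0_INR; lia).
    pose proof (powerRZ_lt (INR N) (m + 1) H0). pose proof (exp_pos (5 / 100 * INR N)).
    repeat apply Rmult_le_pos; lra.
  - intros t Ht. set (z := Cadd a (Cmul (RtoC t) (Csub b a))).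
    assert (Hz : admissible (Re z) (Im z)).
    { specialize (Hab t Ht).
      replace (Re z) with (Re a + t * (Re b - Re a)) by (unfold z; simpl; ring).
      replace (Im z) with (Im a + t * (Im b - Im a)) by (unfold z; simpl; ring). auto. }
    destruct (H N z HN Hz) as (H1 & H2 & H3). split; auto.
    apply (Ccontinuous_integrand m N (fun s => Cadd a (Cmul (RtoC s) (Csub b a))) t H1 H2).
    apply Ccontinuous_add; [apply Ccontinuous_const|].
    apply Ccontinuous_mul; [apply Ccontinuous_RtoC|apply Ccontinuous_const].
Qed.

(** * The six segments of the contour *)

Lemma admissible_left (x y : R) :
  -100 <= x <= - (2 / 10) -> Rabs y <= 100 ->
  (forall K, (1 <= K)%nat -> growth x y K <= 495 / 10000) -> admissible x y.
Proof. intros; right; right; auto. Qed.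

Lemma segment_L1 : admissible_segment P1 P2.
Proof.
  intros t Ht. pose proof PI_bounds. left. simpl. split; [ring|nra].
Qed.

Lemma segment_L2 : admissible_segment P2 P3.
Proof.
  intros t Ht. pose proof PI_bounds. simpl.
  replace (8 * PI / 5 + t * (8 * PI / 5 - 8 * PI / 5)) with (8 * PI / 5) by ring.
  set (x := 2 * PI + t * (- (PI / 10) - 2 * PI)).
  assert (- (PI / 10) <= x <= 2 * PI) by (unfold x; nra).
  (* L2 crosses the line x = -1/5, where the sine estimate gives way to the series. *)
  destruct (Rle_dec (- (2 / 10)) x).
  - right; left; split; lra.
  - apply admissible_left; [lra|apply Rabs_le; lra|].
    intros K HK. apply growth_on_L2; auto; lra.
Qed.

Lemma segment_L3 (w0 : Cx) :
  -219 / 1000 <= Re (c_of w0) <= -212 / 1000 -> Im (c_of w0) = 1 ->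
  admissible_segment P3 (P4 w0).
Proof.
  intros Ha Hi t Ht. pose proof PI_bounds.
  unfold P3, P4, Cmul, RtoC; cbn [Re Im]. rewrite Hi. set (a := Re (c_of w0)) in *.
  replace (- (PI / 10) + t * (2 * PI * a - 0 * 1 - - (PI / 10))) with
    (- (PI / 10) + t * (2 * PI * a + PI / 10)) by ring.
  replace (8 * PI / 5 + t * (2 * PI * 1 + 0 * a - 8 * PI / 5)) with
    (8 * PI / 5 + t * (2 * PI - 8 * PI / 5)) by ring.
  assert (-2 <= 2 * PI * a <= - (PI / 10)) by nra.
  apply admissible_left.
  - split; nra.
  - apply Rabs_le; split; nra.
  - intros K HK. apply growth_on_L3; auto.
Qed.

Lemma segment_L5 (w0 : Cx) :
  -219 / 1000 <= Re (c_of w0) <= -212 / 1000 -> Im (c_of w0) = 1 ->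
  admissible_segment (P5 w0) (P6 w0).
Proof.
  intros Ha Hi t Ht. pose proof PI_bounds.
  unfold P5, P6, Cmul, RtoC; cbn [Re Im]. rewrite Hi. set (a := Re (c_of w0)) in *.
  match goal with |- admissible ?u ?v =>
    replace u with (PI * (3 + 3 * t) * a) by ring;
    replace v with (PI * (3 + 3 * t)) by ring end.
  assert (9 <= PI * (3 + 3 * t) <= 20) by nra.
  apply admissible_left.
  - split; nra.
  - apply Rabs_le; lra.
  - intros K HK. apply growth_on_L5; auto; lra.
Qed.

Lemma segment_L6 (w0 : Cx) :
  -219 / 1000 <= Re (c_of w0) <= -212 / 1000 -> Im (c_of w0) = 1 ->
  admissible_segment (P6 w0) P7.
Proof.
  intros Ha Hi t Ht. pose proof PI_bounds.
  unfold P6, P7, Cmul, RtoC; cbn [Re Im]. rewrite Hi. set (a := Re (c_of w0)) in *.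
  match goal with |- admissible ?u ?v =>
    set (x := u); replace v with (6 * PI) by ring end.
  set (X := 6 * PI * a) in *.
  assert (HX : - (20 * PI) <= X <= 6 * PI * (-212 / 1000)) by (unfold X; split; nra).
  assert (Ex : x = X - t * (20 * PI + X)) by (unfold x; ring).
  assert (Hx : - (20 * PI) <= x <= X) by (rewrite Ex; split; nra).
  apply admissible_left; [lra|apply Rabs_le; lra|].
  intros K HK. apply growth_on_L6; auto; lra.
Qed.

Lemma segment_L7 : admissible_segment P7 P8.
Proof.
  intros t Ht. pose proof PI_bounds. simpl.
  match goal with |- admissible ?u ?v =>
    replace u with (- (20 * PI)) by ring; set (y := v) end.
  assert (0 <= y <= 6 * PI) by (unfold y; nra).
  apply admissible_left; [lra|apply Rabs_le; lra|].
  intros K HK. apply growth_on_L7; auto.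
Qed.

Theorem theorem3p1 :
  forall w0 : Cx,
    Li2_is w0 (Cmul (Cmul (RtoC (2 * PI)) Ci) (Clog w0)) ->
    Cnorm (Csub w0 w0_approx) < / 10000000 ->
  forall m : Z,
  exists K : R,
  forall N : nat, (1 <= N)%nat ->
  exists I1 I2 I3 I5 I6 I7 : Cx,
    seg_integral (integrand m N) P1 P2 I1 /\
    seg_integral (integrand m N) P2 P3 I2 /\
    seg_integral (integrand m N) P3 (P4 w0) I3 /\
    seg_integral (integrand m N) (P5 w0) (P6 w0) I5 /\
    seg_integral (integrand m N) (P6 w0) P7 I6 /\
    seg_integral (integrand m N) P7 P8 I7 /\
    Cnorm (Cadd I1 (Cadd I2 (Cadd I3 (Cadd I5 (Cadd I6 I7)))))
      <= K * powerRZ (INR N) (m + 1) * exp (5 / 100 * INR N).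
Proof.
  intros w0 _ Hw m.
  destruct (w0_argument_bounds w0 Hw) as [Ha Hi].
  destruct (seg_integral_admissible m) as (K & HK & H).
  set (len := Cnorm (Csub P2 P1) + (Cnorm (Csub P3 P2) + (Cnorm (Csub (P4 w0) P3)
    + (Cnorm (Csub (P6 w0) (P5 w0)) + (Cnorm (Csub P7 (P6 w0)) + Cnorm (Csub P8 P7)))))).
  (* The 2 comes from bounding the norm of the total by |Re| + |Im|. *)
  exists (2 * K * len). intros N HN.
  destruct (H N _ _ HN segment_L1) as (I1 & S1 & R1 & J1).
  destruct (H N _ _ HN segment_L2) as (I2 & S2 & R2 & J2).
  destruct (H N _ _ HN (segment_L3 w0 Ha Hi)) as (I3 & S3 & R3 & J3).
  destruct (H N _ _ HN (segment_L5 w0 Ha Hi)) as (I5 & S5 & R5 & J5).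
  destruct (H N _ _ HN (segment_L6 w0 Ha Hi)) as (I6 & S6 & R6 & J6).
  destruct (H N _ _ HN segment_L7) as (I7 & S7 & R7 & J7).
  exists I1, I2, I3, I5, I6, I7. do 6 (split; [assumption|]).
  set (M := K * powerRZ (INR N) (m + 1) * exp (5 / 100 * INR N)) in *.
  replace (2 * K * len * powerRZ (INR N) (m + 1) * exp (5 / 100 * INR N)) with
    (M * len + M * len) by (unfold M; ring).
  unfold len. rewrite !Rmult_plus_distr_l.
  apply Cnorm_le_Rabs; cbn [Re Im Cadd];
    repeat (eapply Rle_trans; [apply Rabs_triang|apply Rplus_le_compat; auto]).
Qed.
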